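(* Let $\mathbb{H}\in\mathbb{R}_+^{n_R\times n_T}$ have rank $r\ge1$ with reduced channel matrix $\widetilde{\mathbb{H}}\in\mathbb{R}^{r\times n_T}$, the transmitters being indexed so that with $\mathcal{I}=\{1,\dots,r\}$ one has $\det(\widetilde{\mathbb{H}}_{\mathcal{I}})\ne0$. Let $\boldsymbol{\alpha}\in[0,1]^{n_T}$, $\sigma>0$, let $\mathbb{B}_{\mathsf E}^{\dagger}\in\mathbb{R}^{r\times(n_T-r)}$ be the precoding matrix produced by the equal-cost circular iterative optimization, and let $D_{\mathsf E}=\big|\det\big(\widetilde{\mathbb{H}}_{\mathcal{I}}+\widetilde{\mathbb{H}}_{\mathcal{I}^c}(\mathbb{B}_{\mathsf E}^{\dagger})^{\mathsf T}\big)\big|$. Then the capacity under equal-cost constraints is lower-bounded (by a rate achieved with linear precoding) as $$\mathsf{C}_{\mathsf E}(\widetilde{\mathbb{H}},\boldsymbol{\alpha},\sigma)\ge\frac r2\log\left(1+\frac{D_{\mathsf E}^{2/r}\exp\!\Big(\frac2r\sum_{i=1}^r\mathfrak{h}_{\mathrm{TE}}(\alpha_i)\Big)}{2\pi e\sigma^2}\right).$$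
   Context: Reduced channel: with $\sigma_1\ge\cdots\ge\sigma_r>0$ the nonzero singular values of $\mathbb{H}$ and $\mathbf{v}_1,\dots,\mathbf{v}_r$ orthonormal eigenvectors of $\mathbb{H}^{\mathsf T}\mathbb{H}$ for $\sigma_1^2,\dots,\sigma_r^2$, $\widetilde{\mathbb{H}}=\operatorname{diag}(\sigma_1,\dots,\sigma_r)[\mathbf{v}_1,\dots,\mathbf{v}_r]^{\mathsf T}$; its columns are $\mathbf{h}_1,\dots,\mathbf{h}_{n_T}$. $\widetilde{\mathbb{H}}_{\mathcal{J}}$ is the submatrix of columns indexed by $\mathcal{J}$, and $\mathcal{I}^c=\{r+1,\dots,n_T\}$. Capacity: $\mathsf{C}_{\mathsf E}(\widetilde{\mathbb{H}},\boldsymbol{\alpha},\sigma)=\sup I(\mathbf{X};\widetilde{\mathbb{H}}\mathbf{X}+\widetilde{\mathbf{Z}})$, $\widetilde{\mathbf{Z}}\sim\mathcal{N}(\mathbf{0}_r,\sigma^2\mathbb{I}_r)$ independent of $\mathbf{X}$, supremum over laws of $\mathbf{X}$ with $0\le X_k\le1$ a.s. and $\mathbb{E}[X_k]=\alpha_k$ for all $k$ (equal-cost constraints). Logarithms are natural. $\mathfrak{h}_{\mathrm{TE}}(\alpha)$: for $\alpha\in(0,1)$, $\mathfrak{h}_{\mathrm{TE}}(\alpha)=-(1-\alpha)\mu_\alpha-\ln(1-\alpha\mu_\alpha)$ where $\mu_\alpha\in\mathbb{R}$ is the unique solution of $\alpha=\frac1{\mu_\alpha}-\frac1{e^{\mu_\alpha}-1}$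 (with $\mu_{1/2}=0$, $\mathfrak{h}_{\mathrm{TE}}(1/2)=0$ by continuity); this is the maximum differential entropy of a $[0,1]$-valued random variable with mean $\alpha$. For $\alpha\in\{0,1\}$, $\mathfrak{h}_{\mathrm{TE}}(\alpha)=-\infty$, $\exp(-\infty)=0$. Linear precoding: inputs $X_{j+r}$, $j=1,\dots,n_T-r$, are affine functions $X_{j+r}-\frac12=\mathbf{b}_j^{\mathsf T}(\mathbf{X}_{\mathcal{I}}-\frac12\mathbf{1})+c_j$ of $\mathbf{X}_{\mathcal{I}}=(X_1,\dots,X_r)^{\mathsf T}$, with $c_j\in\mathbb{R}$, and $\mathbb{B}=[\mathbf{b}_1,\dots,\mathbf{b}_{n_T-r}]$. Equal-cost circular iterative optimization: fix a number $n_{\mathrm{cycle}}\ge1$ of cycles and start with $\mathbf{b}_1=\dots=\mathbf{b}_{n_T-r}=\mathbf{0}$. In each cycle, for $j=1,\dots,n_T-r$ successively, put $\mathbb{A}=\widetilde{\mathbb{H}}_{\mathcal{I}}+\sum_{k\ne j}\mathbf{h}_{k+r}\mathbf{b}_k^{\mathsf T}$ (assumed invertible), $\mathbf{w}=\mathbb{A}^{-1}\mathbf{h}_{j+r}$, $\mathcal{K}=\{k\in\{1,\dots,r\}:w_k\ge0\}$, $\mathcal{K}^c=\{1,\dots,r\}\setminus\mathcal{K}$, $\mathbf{w}_1=\mathbf{w}_{\mathcal{K}}$, $\mathbf{w}_2=-\mathbf{w}_{\mathcal{K}^c}$, $\boldsymbol{\alpha}_1=\boldsymbol{\alpha}_{\mathcal{K}}$,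 $\boldsymbol{\alpha}_2=\boldsymbol{\alpha}_{\mathcal{K}^c}$. For $t\in\{1,2\}$ let $\boldsymbol{\mu}_t^\star$ be a solution of the linear program: maximize $\mathbf{w}_t^{\mathsf T}\boldsymbol{\mu}_t$ subject to $\boldsymbol{\mu}_t\ge\mathbf{0}$ (entrywise), $\boldsymbol{\alpha}_t^{\mathsf T}\boldsymbol{\mu}_t\le\alpha_{j+r}$, $(\mathbf{1}-\boldsymbol{\alpha}_t)^{\mathsf T}\boldsymbol{\mu}_t\le1-\alpha_{j+r}$. If $1+\mathbf{w}_1^{\mathsf T}\boldsymbol{\mu}_1^\star\ge|1-\mathbf{w}_2^{\mathsf T}\boldsymbol{\mu}_2^\star|$, replace $\mathbf{b}_j$ by the vector equal to $\boldsymbol{\mu}_1^\star$ on $\mathcal{K}$ and $\mathbf{0}$ on $\mathcal{K}^c$; otherwise by the vector equal to $\boldsymbol{\mu}_2^\star$ on $\mathcal{K}^c$ and $\mathbf{0}$ on $\mathcal{K}$. The final $[\mathbf{b}_1,\dots,\mathbf{b}_{n_T-r}]$ is $\mathbb{B}_{\mathsf E}^\dagger$. *)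

(* Defs.v *)
From HB Require Import structures.
From mathcomp Require Import all_boot all_order all_algebra.
From mathcomp Require Import all_classical all_reals all_analysis.

Set Implicit Arguments.
Unset Strict Implicit.
Unset Printing Implicit Defensive.

Import Order.TTheory GRing.Theory Num.Theory.
Local Open Scope classical_set_scope.
Local Open Scope ring_scope.

Section reduced_channel.
Variable R : realType.

(* The characteristic polynomial accounts for multiplicities: the eigenvalues
   of H^T H are s_1^2, ..., s_r^2, and 0 with multiplicity n - r. *)
Definition nonzero_singular_values p n r (H : 'M[R]_(p, n)) (s : 'rV[R]_r) :=
  [/\ forall i, 0 < s 0 i,
      forall i j : 'I_r, (i <= j)%N -> s 0 j <= s 0 i &
      char_poly (H^T *m H) =
        'X^(n - r) * \prod_(i < r) ('X - (s 0 i ^+ 2)%:P)].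

(* Relational, because the orthonormal eigenvectors (the columns of V) are not
   unique. *)
Definition reduced_channel p n r (H : 'M[R]_(p, n)) (Ht : 'M[R]_(r, n)) :=
  exists (s : 'rV[R]_r) (V : 'M[R]_(n, r)),
    [/\ nonzero_singular_values H s,
        V^T *m V = 1%:M,
        forall i, H^T *m H *m col i V = s 0 i ^+ 2 *: col i V &
        Ht = diag_mx s *m V^T].

End reduced_channel.

Section information.
Variable R : realType.

Section kl.
Context d (T : measurableType d).
Local Open Scope ereal_scope.
Local Open Scope charge_scope.

Definition kl_divergence (P Q : probability T R) : \bar R :=
  if `[< P `<< Q >] then
    \int[P]_x lne (('d (charge_of_finite_measure P) '/d Q) x)
  else +oo.

End kl.

Section mutual_information.
Context d d1 d2 (T : measurableType d) (T1 : measurableType d1)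
  (T2 : measurableType d2) (P : probability T R).
Variables (X : {mfun T >-> T1}) (Y : {mfun T >-> T2}).

Let XY (t : T) : T1 * T2 := (X t, Y t).

Let measurable_XY : measurable_fun [set: T] XY.
Proof. by apply: measurable_fun_pair. Qed.

HB.instance Definition _ := isMeasurableFun.Build _ _ _ _ XY measurable_XY.

Definition mutual_information : \bar R :=
  kl_divergence (distribution P XY : probability _ R)
    ((distribution P X \x distribution P Y)%E : probability _ R).

End mutual_information.
End information.

Section gaussian_vector.
Variable R : realType.

(* [normal_prob] lives on [measurableTypeR R], whose sigma-algebra is the Borel
   one of [R] under another display; the identity transports it to [R]. *)
Let to_R : measurableTypeR R -> R := idfun.

Let measurable_to_R : measurable_fun [set: measurableTypeR R] to_R.
Proof. exact: (@measurable_id _ _ setT). Qed.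

HB.instance Definition _ :=
  isMeasurableFun.Build _ _ _ _ to_R measurable_to_R.

Definition normal_law (m s : R) : probability R R :=
  distribution (normal_prob m s) to_R.

Definition tuple_cons n (x : R * n.-tuple R) : n.+1.-tuple R :=
  [the n.+1.-tuple R of x.1 :: x.2].

Let measurable_tuple_cons n :
  measurable_fun [set: R * n.-tuple R] (@tuple_cons n).
Proof. by apply: measurable_cons. Qed.

HB.instance Definition _ n :=
  isMeasurableFun.Build _ _ _ _ (@tuple_cons n) (@measurable_tuple_cons n).

Fixpoint iid_law (P : probability R R) n : probability (n.-tuple R) R :=
  match n with
  | 0 => \d_[tuple]
  | n'.+1 => distribution (P \x iid_law P n')%E (@tuple_cons n')
  end.

(* The law N(0, s^2 I_n). *)
Definition gaussian_law (s : R) n : probability (n.-tuple R) R :=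
  iid_law (normal_law 0 s) n.

End gaussian_vector.

Section capacity.
Variable R : realType.

Definition vec_of_tuple n (x : n.-tuple R) : 'cV[R]_n := \col_k tnth x k.

Section channel.
Variables (r n : nat) (Ht : 'M[R]_(r, n)).

(* Sample points are pairs u = (x, z) of an input and a noise vector. *)
Definition channel_input (u : n.-tuple R * r.-tuple R) : n.-tuple R := u.1.

Let measurable_channel_input :
  measurable_fun [set: n.-tuple R * r.-tuple R] channel_input.
Proof. exact: measurable_fst. Qed.

HB.instance Definition _ :=
  isMeasurableFun.Build _ _ _ _ channel_input measurable_channel_input.

Definition channel_output (u : n.-tuple R * r.-tuple R) : r.-tuple R :=
  [tuple (Ht *m vec_of_tuple u.1) i 0 + tnth u.2 i | i < r].

Let measurable_channel_output :
  measurable_fun [set: n.-tuple R * r.-tuple R] channel_output.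
Proof.
apply/measurable_fun_tnthP => i.
rewrite (_ : _ \o _ = fun u : n.-tuple R * r.-tuple R =>
    \sum_k Ht i k * tnth u.1 k + tnth u.2 i); last first.
  apply/funext => u /=; rewrite tnth_mktuple mxE; congr (_ + _).
  by apply: eq_bigr => k _; rewrite mxE.
apply: measurable_realfun.measurable_funD.
  apply: measurable_sum => k; apply: measurable_realfun.measurable_funM => //.
  by apply: (measurableT_comp (measurable_tnth k)).
by apply: (measurableT_comp (measurable_tnth i)).
Qed.

HB.instance Definition _ :=
  isMeasurableFun.Build _ _ _ _ channel_output measurable_channel_output.

(* I(X; Ht X + Z) for X of law PX and Z ~ N(0, sigma^2 I_r) independent of X. *)
Definition information_rate (sigma : R) (PX : probability (n.-tuple R) R)
    : \bar R :=
  mutual_information (PX \x gaussian_law sigma r)%E channel_input channel_output.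

Definition equal_cost_law (alpha : 'cV[R]_n) (PX : probability (n.-tuple R) R)
    : Prop :=
  forall k, {ae PX, forall x, 0 <= tnth x k <= 1} /\
    ('E_PX[fun x => tnth x k] = (alpha k 0)%:E)%E.

Definition capacity_E (alpha : 'cV[R]_n) (sigma : R) : \bar R :=
  ereal_sup [set information_rate sigma PX | PX in equal_cost_law alpha].

End channel.

(* The first r inputs are free, the last m are affine functions of them. *)
Definition precoded_law r m (B : 'M[R]_(r, m))
    (PX : probability ((r + m).-tuple R) R) : Prop :=
  exists c : 'I_m -> R, {ae PX, forall x, forall j : 'I_m,
    tnth x (rshift r j) - 2^-1 =
      \sum_(i < r) B i j * (tnth x (lshift m i) - 2^-1) + c j}.

End capacity.

Section max_entropy.
Variable R : realType.

(* mu = 0 is the removable singularity, where the right-hand side tends to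
   1/2. *)
Definition te_equation (alpha mu : R) : Prop :=
  if mu == 0 then alpha = 2^-1 else alpha = mu^-1 - (expR mu - 1)^-1.

Definition te_parameter (alpha : R) : R := xget 0 [set mu | te_equation alpha mu].

Definition h_TE (alpha : R) : \bar R :=
  if 0 < alpha < 1 then
    (- (1 - alpha) * te_parameter alpha
     - ln (1 - alpha * te_parameter alpha))%:E
  else -oo%E.

End max_entropy.

Section circular_optimization.
Variable R : realType.
Variables r m : nat.

(* Vectors indexed by K are represented by vectors of R^r, of which only the
   entries in K matter. *)
Definition lp_feasible (K : {set 'I_r}) (a : 'cV[R]_r) (a0 : R)
    (mu : 'cV[R]_r) : Prop :=
  [/\ forall k, k \in K -> 0 <= mu k 0,
      \sum_(k in K) a k 0 * mu k 0 <= a0 &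
      \sum_(k in K) (1 - a k 0) * mu k 0 <= 1 - a0].

Definition lp_solution (K : {set 'I_r}) (v a : 'cV[R]_r) (a0 : R)
    (mu : 'cV[R]_r) : Prop :=
  lp_feasible K a a0 mu /\
  forall nu, lp_feasible K a a0 nu ->
    \sum_(k in K) v k 0 * nu k 0 <= \sum_(k in K) v k 0 * mu k 0.

Variables (Ht : 'M[R]_(r, r + m)) (alpha : 'cV[R]_(r + m)).

Definition replace_col (B : 'M[R]_(r, m)) (j : 'I_m) (b : 'cV[R]_r) :=
  \matrix_(i < r, k < m) if k == j then b i 0 else B i k.

(* One update of b_j, the columns of B being b_1, ..., b_m; relational because
   the linear programs may have several solutions. The assumed invertibility of
   A is part of the step. *)
Definition update_step (j : 'I_m) (B B' : 'M[R]_(r, m)) : Prop :=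
  let A := lsubmx Ht
           + \sum_(k < m | k != j) col (rshift r k) Ht *m (col k B)^T in
  let w := invmx A *m col (rshift r j) Ht in
  let K := [set k : 'I_r | 0 <= w k 0]%SET in
  let a := usubmx alpha in
  let a0 := alpha (rshift r j) 0 in
  A \in unitmx /\
  exists mu1 mu2 : 'cV[R]_r,
    [/\ lp_solution K w a a0 mu1,
        lp_solution (~: K)%SET (- w) a a0 mu2 &
        B' = replace_col B j
          (if `|1 - \sum_(k in ~: K) (- w) k 0 * mu2 k 0|
              <= 1 + \sum_(k in K) w k 0 * mu1 k 0
           then \col_k (if k \in K then mu1 k 0 else 0)
           else \col_k (if k \in K then 0 else mu2 k 0))].

Fixpoint update_steps (js : seq 'I_m) (B B' : 'M[R]_(r, m)) : Prop :=
  if js is j :: js' then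
    exists2 B1, update_step j B B1 & update_steps js' B1 B'
  else B' = B.

Definition circular_optimization_E (ncycle : nat) (B : 'M[R]_(r, m)) : Prop :=
  update_steps (flatten (nseq ncycle (enum 'I_m))) 0 B.

End circular_optimization.

(* Main.v *)
Require Import Defs.
From HB Require Import structures.
From mathcomp Require Import all_boot all_order all_algebra.
From mathcomp Require Import all_classical all_reals all_analysis.
From mathcomp Require Import measurable_realfun.
From mathcomp Require Import ring lra.

(** The input is X_i = t_i(x_i) for i <= r, with x_i independent standard normal
    variables and t_i the increasing map that carries the normal law to the
    truncated exponential law of mean alpha_i, and the other inputs follow by
    the affine precoding. After a QR decomposition of the precoded channel, the
    whitened output is L X + n with L upper triangular and n white.

    The mutual information is bounded below by the Donsker-Varadhan inequality
    KL(P, Q) >= E_P s, valid as soon as E_Q e^s <= 1. The score s comes from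
    Rioul's transport proof of the entropy power inequality: rotate each pair
    (x_i, n_i) by an angle with cosine a and sine b into y_i = a x_i - b n_i.
    For a fixed output, y_i increases with x_i, so the density of y_i times
    dy_i/dx_i has integral at most 1; the triangular shape of L lets the
    coordinates be integrated out one at a time. The log of the Jacobian
    a + b L_ii t_i' is bounded below by weighted AM-GM, which leaves a quadratic
    score whose mean is explicit in ln L_ii and the entropies; the angle with
    tan^2 = N, the signal-to-noise ratio in the statement, gives the rate. *)

Set Implicit Arguments.
Unset Strict Implicit.
Unset Printing Implicit Defensive.

Import Order.TTheory GRing.Theory Num.Theory.
Import numFieldNormedType.Exports.
Local Open Scope classical_set_scope.
Local Open Scope ring_scope.

(** * Variational lower bound for the Kullback-Leibler divergence *)

Section kl_lower_bound.
Context d (T : measurableType d) (R : realType).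
Local Open Scope ereal_scope.

(** Replacing [g] by [maxe f g] changes it only on a null set and makes the inequality hold
    everywhere; positive and negative parts are then compared separately. This allows [g] to be the
    logarithm of a density, whose integral may be infinite. *)
Lemma ae_le_integral (P : probability T R) (f g : T -> \bar R) :
  P.-integrable [set: T] f -> measurable_fun [set: T] g ->
  {ae P, forall x, f x <= g x} -> \int[P]_x f x <= \int[P]_x g x.
Proof.
move=> intf mg fg; have mf := measurable_int _ intf.
pose h x := maxe (f x) (g x).
have mh : measurable_fun [set: T] h by exact: measurable_maxe.
have -> : \int[P]_x g x = \int[P]_x h x.
  apply: ae_eq_integral => //; apply: filterS fg => x /= fgx _.
  by rewrite /h; apply/esym/max_idPr.
have fh x : f x <= h x by rewrite le_max lexx.
rewrite integralE [leRHS]integralE leeB//.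
- apply: ge0_le_integral => //; first exact: measurable_funepos.
    exact: measurable_funepos.
  by move=> x _; apply: (@funepos_le _ _ setT) => //; rewrite in_setT.
- apply: ge0_le_integral => //; first exact: measurable_funeneg.
    exact: measurable_funeneg.
  by move=> x _; apply: (@funeneg_le _ _ setT) => //; rewrite in_setT.
Qed.

Lemma measurable_lne (f : T -> \bar R) :
  measurable_fun [set: T] f -> (forall x, f x \is a fin_num) ->
  measurable_fun [set: T] (@lne R \o f).
Proof.
move=> mf ffin.
have mff : measurable_fun [set: T] (fine \o f) by exact: measurableT_comp.
rewrite (_ : @lne R \o f = fun x =>
    if (fine (f x) <= 0)%R then -oo else (ln (fine (f x)))%:E); last first.
  by apply/funext => x /=; rewrite -{1}(fineK (ffin x)).
apply: measurable_fun_ifT => //.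
- by apply: (measurable_fun_ler (f := fine \o f) (g := cst 0%R)).
- by apply/measurable_EFinP; apply: (measurableT_comp (f := @ln R)).
Qed.

(* From [ln u >= 1 - 1 / u] at [u = (dP/dQ) / expR s]. *)
Lemma kl_divergence_ge (P Q : probability T R) (s : T -> R) :
  measurable_fun [set: T] s -> P.-integrable [set: T] (EFin \o s) ->
  \int[Q]_x (expR (s x))%:E <= 1 ->
  \int[P]_x (s x)%:E <= kl_divergence P Q.
Proof.
move=> ms ints Qs; rewrite /kl_divergence; case: asboolP => PQ; last exact: leey.
set f := Radon_Nikodym _ _.
pose g := Radon_Nikodym_SigmaFinite.f P Q.
have g0 x : 0 <= g x by exact: Radon_Nikodym_SigmaFinite.f_ge0.
have gfin x : g x \is a fin_num by exact: Radon_Nikodym_SigmaFinite.f_fin_num.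
have mg : measurable_fun [set: T] g.
  exact: measurable_int (Radon_Nikodym_SigmaFinite.f_integrable _).
have mf : measurable_fun [set: T] f by exact: measurable_int (Radon_Nikodym_integrable _).
have ffin x : f x \is a fin_num by exact: Radon_Nikodym_fin_num.
(* Two versions of the density agree [Q]-almost everywhere, hence [P]-almost everywhere by
   domination. *)
have fgP : {ae P, forall x, g x = f x}.
  have [N [mN QN subN]] : ae_eq Q setT g f.
    exact: ae_eq_Radon_Nikodym_SigmaFinite.
  exists N; split => //.
    by apply: (PQ N) => //; apply/measure0_null_setP.
  by apply: subset_trans subN => x /= + /(_ I).
(* The [P]-measure of the zero set of [g] is the [Q]-integral of [g] over it. *)
have gP : {ae P, forall x, (0 < fine (g x))%R}.
  exists [set x | g x = 0]; split.
  - rewrite (_ : [set _ | _] = setT `&` g @^-1` [set 0])//; last first.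
      by rewrite setTI.
    exact: mg.
  - have m0 : measurable (g @^-1` [set 0]) by rewrite -[X in measurable X]setTI; exact: mg.
    rewrite (Radon_Nikodym_SigmaFinite.f_integral PQ)//.
    by apply: integral0_eq => x.
  - move=> x /= /negP; rewrite -leNgt => gx0.
    by apply/eqP; rewrite -(fineK (gfin x)) eqe eq_le gx0 fine_ge0.
pose k x := expR (s x - ln (fine (g x))).
have k0 x : (0 <= k x)%R by exact: expR_ge0.
have mk : measurable_fun [set: T] k.
  apply: measurableT_comp => //; apply: measurable_funB => //.
  by apply: measurableT_comp => //; exact: measurableT_comp.
have ik1 : \int[P]_x (k x)%:E <= 1.
  rewrite -(Radon_Nikodym_SigmaFinite.change_of_variables PQ)//; last first.
    exact/measurable_EFinP.
  apply: le_trans Qs; apply: ge0_le_integral => //.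
  - by move=> x _; apply: mule_ge0; [rewrite lee_fin|exact: g0].
  - by apply: emeasurable_funM => //; exact/measurable_EFinP.
  - by apply/measurable_EFinP; exact: measurableT_comp.
  - move=> x _; rewrite -/g -(fineK (gfin x)) -EFinM lee_fin /k.
    have [->|gx0] := eqVneq (fine (g x)) 0%R; first by rewrite mulr0 expR_ge0.
    by rewrite expRD expRN lnK ?divfK// posrE lt_def gx0 fine_ge0.
have intk : P.-integrable [set: T] (EFin \o k).
  apply/integrableP; split; first exact/measurable_EFinP.
  under eq_integral do rewrite /= ger0_norm//.
  exact: le_lt_trans ik1 (ltry _).
have int1 : P.-integrable [set: T] (EFin \o cst 1%R).
  exact: finite_measure_integrable_cst.
have int1k : P.-integrable [set: T] (EFin \o (cst 1%R \- k)%R).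
  rewrite (_ : _ \o _ = (EFin \o cst 1%R) \- (EFin \o k))//.
  exact: integrableB.
have intphi : P.-integrable [set: T] (EFin \o (s \+ (cst 1%R \- k))%R).
  rewrite (_ : _ \o _ = (EFin \o s) \+ (EFin \o (cst 1%R \- k)%R))//.
  exact: integrableD.
(* Adding [1 - k] can only increase the integral, and [s + 1 - k] lies below the log-density
   pointwise where [g] is positive. *)
apply: (@le_trans _ _ (\int[P]_x ((s \+ (cst 1%R \- k))%R x)%:E)).
  have -> : \int[P]_x ((s \+ (cst 1%R \- k))%R x)%:E =
      \int[P]_x (s x)%:E + \int[P]_x ((cst 1%R \- k)%R x)%:E.
    exact: integralD_EFin.
  rewrite leeDl//.
  have -> : \int[P]_x ((cst 1%R \- k)%R x)%:E =
      \int[P]_x (cst 1%R x)%:E - \int[P]_x (k x)%:E.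
    exact: integralB_EFin.
  have -> : \int[P]_x (cst 1%R x)%:E = 1.
    by have := integral_cst P measurableT 1; rewrite /= probability_setT mul1e.
  by rewrite sube_ge0// ge0_fin_numE ?(le_lt_trans ik1) ?ltry// integral_ge0// => x _; rewrite lee_fin.
apply: ae_le_integral => //; first exact: measurable_lne.
apply: filterS2 fgP gP => x <- gx0.
rewrite -(fineK (gfin x)) lne_EFin// lee_fin /= /k.
have := expR_ge1Dx (s x - ln (fine (g x)))%R; lra.
Qed.

End kl_lower_bound.

(** * Normal densities and improper integrals *)

Section standard_normal.
Context {R : realType}.
Notation mu := (@lebesgue_measure R).

Lemma ge0_integral_normal_law (m s : R) (f : R -> \bar R) :
  measurable_fun [set: R] f -> (forall x, 0 <= f x)%E ->
  (\int[normal_law m s]_x f x = \int[mu]_x (f x * (normal_pdf m s x)%:E))%E.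
Proof.
move=> mf f0; rewrite /normal_law ge0_integral_distribution//.
have dom := @normal_prob_dominates R m s.
rewrite -[LHS](Radon_Nikodym_SigmaFinite.change_of_variables dom)//.
apply: ae_eq_integral => //.
- apply: emeasurable_funM => //.
  exact: measurable_int (Radon_Nikodym_SigmaFinite.f_integrable _).
- apply: emeasurable_funM => //; apply/measurable_EFinP.
  exact: measurable_normal_pdf.
(* The abstract density is identified with [normal_pdf] by comparing integrals over all measurable
   sets. *)
- have : ae_eq mu [set: R] (Radon_Nikodym_SigmaFinite.f (normal_prob m s) mu)
      (EFin \o normal_pdf m s).
    apply: integral_ae_eq => //.
    + exact: Radon_Nikodym_SigmaFinite.f_integrable.
    + by apply/measurable_EFinP; exact: measurable_normal_pdf.
    + move=> E _ mE; rewrite -(Radon_Nikodym_SigmaFinite.f_integral dom)//.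
  by apply: filterS => x /= h _; rewrite h.
Qed.

Section normal_cdf.
Variable s : R.
Hypothesis s0 : s != 0.

Definition normal_cdf (x : R) : R :=
  (\int[mu]_(t in `]-oo, x]) normal_pdf 0 s t)%R.

Lemma is_derive_normal_cdf (x : R) : is_derive x 1 normal_cdf (normal_pdf 0 s x).
Proof.
have [||||d e] := @continuous_FTC1 R (normal_pdf 0 s) -oo%O x (x + 1).
- by rewrite ltrDl.
- apply: (@integrableS _ _ _ mu [set: R]) => //.
  exact: integrable_normal_pdf.
- by rewrite ltNyr.
- exact: continuous_normal_pdf.
- by apply: DeriveDef => //; rewrite -derive1E.
Qed.

Lemma normal_cdf_fine x : (normal_cdf x)%:E = normal_law 0 s `]-oo, x]%classic.
Proof.
rewrite /normal_cdf /Rintegral fineK//.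
exact: (@fin_num_measure _ _ _ (normal_law 0 s) `]-oo, x]%classic (measurable_itv _)).
Qed.

Lemma normal_cdf_itv x : 0 <= normal_cdf x <= 1.
Proof. by rewrite -!lee_fin normal_cdf_fine measure_ge0 probability_le1. Qed.

Lemma normal_cdf_cvgy : normal_cdf x @[x --> +oo] --> (1 : R).
Proof.
pose idm : {mfun R >-> R} := HB.pack (idfun : R -> R)
  (isMeasurableFun.Build _ _ R R idfun (@measurable_id _ R setT)).
have := @cvg_cdfy1 _ _ R (normal_law 0 s) idm.
rewrite (_ : cdf _ = EFin \o normal_cdf); last first.
  by apply/funext => x; rewrite /= normal_cdf_fine.
by move=> /fine_cvgP[].
Qed.

Lemma normal_cdf_cvgNy : normal_cdf x @[x --> -oo] --> (0 : R).
Proof.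
pose idm : {mfun R >-> R} := HB.pack (idfun : R -> R)
  (isMeasurableFun.Build _ _ R R idfun (@measurable_id _ R setT)).
have := @cvg_cdfNy0 _ _ R (normal_law 0 s) idm.
rewrite (_ : cdf _ = EFin \o normal_cdf); last first.
  by apply/funext => x; rewrite /= normal_cdf_fine.
by move=> /fine_cvgP[].
Qed.

End normal_cdf.

Definition gauss_pdf : R -> R := normal_pdf 0 1.
Definition gauss_cdf : R -> R := normal_cdf 1.

Lemma gauss_pdfE x : gauss_pdf x = normal_peak 1 * expR (- (x ^+ 2) / 2).
Proof.
rewrite /gauss_pdf normal_pdfE ?oner_eq0// /normal_fun subr0 expr1n.
by rewrite -mulr_natr mul1r.
Qed.

Lemma gauss_pdf_gt0 x : 0 < gauss_pdf x.
Proof. by rewrite gauss_pdfE mulr_gt0 ?expR_gt0// normal_peak_gt0// oner_eq0. Qed.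

Lemma continuous_gauss_pdf : continuous gauss_pdf.
Proof. by apply: continuous_normal_pdf; exact: oner_neq0. Qed.

Lemma gauss_cdf_itv x : 0 <= gauss_cdf x <= 1.
Proof. exact: normal_cdf_itv. Qed.

Lemma is_derive_gauss_cdf (x : R) : is_derive x 1 gauss_cdf (gauss_pdf x).
Proof. by apply: is_derive_normal_cdf; exact: oner_neq0. Qed.

Lemma is_derive_gt0_lt (f df : R -> R) :
  (forall x : R, is_derive x 1 f (df x)) -> (forall x, 0 < df x) ->
  {homo f : x y / x < y}.
Proof.
move=> fdf df0 x y xy.
have cf z : {for z, continuous f}.
  by apply: differentiable_continuous; apply/derivable1_diffP.
have [z _ e] := MVT xy (fun z _ => fdf z) (continuous_subspaceT cf).
by rewrite -subr_gt0 e mulr_gt0// subr_gt0.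
Qed.

Lemma gauss_cdf_lt : {homo gauss_cdf : x y / x < y}.
Proof. exact: is_derive_gt0_lt is_derive_gauss_cdf gauss_pdf_gt0. Qed.

Lemma gauss_cdf_oo x : 0 < gauss_cdf x < 1.
Proof.
have /andP[h0 _] := gauss_cdf_itv (x - 1).
have /andP[_ h1] := gauss_cdf_itv (x + 1).
by rewrite (le_lt_trans h0) ?(lt_le_trans _ h1)//; apply: gauss_cdf_lt; lra.
Qed.

(** Fundamental theorem of calculus on the intervals [[-n, n]], then monotone convergence. The
    conclusion is kept as a limit so that it applies before the behaviour of [F] at infinity is
    known. *)
Lemma ge0_integral_FTC_cvg (f F : R -> R) :
  (forall x, 0 <= f x) -> continuous f ->
  (forall x : R, is_derive x 1 F (f x)) ->
  (F n%:R - F (- n%:R))%:E @[n --> \oo] --> (\int[mu]_x (f x)%:E)%E.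
Proof.
move=> f0 cf Ff.
have mf : measurable_fun [set: R] (EFin \o f).
  by apply/measurable_EFinP; exact: continuous_measurable_fun.
have cF z : {for z, continuous F}.
  by apply: differentiable_continuous; apply/derivable1_diffP.
have : (fun n : nat => \int[mu]_(x in `[(- n%:R)%R, n%:R%R]) (f x)%:E)%E @ \oo -->
    (\int[mu]_x (f x)%:E)%E.
  have -> : [set: R] = \bigcup_n (`[- n%:R, n%:R]%classic : set R).
    apply/seteqP; split => // x _.
    exists (Num.trunc `|x|).+1 => //=.
    by rewrite in_itv/= -ler_norml ltW// truncnS_gt.
  apply: ge0_nondecreasing_set_cvg_integral => //.
  - move=> i j ij; apply/subsetPset => x /=; rewrite !in_itv/= -!ler_norml.
    by move=> /le_trans; apply; rewrite ler_nat.
  - by move=> i; exact: measurable_funTS.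
  - by move=> i x _; rewrite lee_fin.
apply: cvg_trans; apply: near_eq_cvg; exists 1%N => // n /= n0.
rewrite (@continuous_FTC2 _ f F)//.
- by rewrite -subr_gt0 opprK -mulr2n pmulrn_lgt0// ltr0n.
- exact: continuous_subspaceT.
- split => //.
  + exact/cvg_at_right_filter/cF.
  + exact/cvg_at_left_filter/cF.
- by move=> x _; rewrite derive1E derive_val.
Qed.

Lemma ge0_integral_FTC_le (f F : R -> R) (l : R) :
  (forall x, 0 <= f x) -> continuous f ->
  (forall x : R, is_derive x 1 F (f x)) ->
  (forall x y, F y - F x <= l) ->
  (\int[mu]_x (f x)%:E <= l%:E)%E.
Proof.
move=> f0 cf Ff Fl; have cv := ge0_integral_FTC_cvg f0 cf Ff.
rewrite -(cvg_lim _ cv)//; apply: lime_le; first by apply/cvg_ex; eexists; exact: cv.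
by apply: nearW => n; rewrite lee_fin.
Qed.

Lemma ge0_integral_FTC (f F : R -> R) (a b : R) :
  (forall x, 0 <= f x) -> continuous f ->
  (forall x : R, is_derive x 1 F (f x)) ->
  F x @[x --> -oo] --> a -> F x @[x --> +oo] --> b ->
  (\int[mu]_x (f x)%:E = (b - a)%:E)%E.
Proof.
move=> f0 cf Ff Fa Fb; have cv := ge0_integral_FTC_cvg f0 cf Ff.
rewrite -(cvg_lim _ cv)//; apply/cvg_lim => //; apply: cvg_EFin; first exact: nearW.
apply: cvgB.
- by apply: (cvg_comp _ _ _ Fb); exact: cvgr_idn.
- apply: (cvg_comp (fun n : nat => - n%:R) F _ Fa).
  apply/cvgNrNy; apply: cvg_trans (@cvgr_idn R).
  by apply: near_eq_cvg; apply: nearW => n.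
Qed.
End standard_normal.

(** * Truncated exponential laws *)

Section truncated_exponential.
Context {R : realType}.

(** The difference vanishes at 0 and has derivative [expR y - (1 + y)], which is nonnegative; the
    mean value theorem concludes. *)
Lemma expR_ge_quadratic (x : R) : 0 <= x -> 1 + x + x ^+ 2 / 2 <= expR x.
Proof.
rewrite le_eqVlt => /predU1P[<-|x0]; first by rewrite expR0 expr0n/= mul0r !addr0.
pose f (y : R) := expR y - (1 + y + 2^-1 * (y * y)).
have df (y : R) : is_derive y 1 f (expR y - (1 + y)).
  by rewrite /f; apply: is_derive_eq; rewrite /GRing.scale/=; lra.
have [|c] := MVT x0 (fun z _ => df z).
  apply: continuous_subspaceT => z.
  by apply: differentiable_continuous; apply/derivable1_diffP.
rewrite in_itv/= => /andP[c0 _].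
have -> : f 0 = 0 by rewrite /f expR0; lra.
rewrite /f subr0 => e.
have : 0 <= expR x - (1 + x + 2^-1 * (x * x)).
  by rewrite e subr0 mulr_ge0 ?ltW// subr_gt0 expR_gt1Dx// gt_eqF.
lra.
Qed.

(** The reflection of the unit interval exchanges the truncated exponential laws of parameters [m]
    and [- m]. It reduces means above one half to means below. *)
Lemma te_equation_opp (a m : R) : te_equation a m -> te_equation (1 - a) (- m).
Proof.
rewrite /te_equation oppr_eq0; case: eqVneq => [_ -> |m0 ->]; first by lra.
have em : expR m - 1 != 0 by rewrite subr_eq0 -[X in _ != X]expR0 (inj_eq (@expR_inj R)).
have e0 : expR m != 0 by rewrite gt_eqF// expR_gt0.
rewrite expRN; field.
by rewrite e0 m0 em mulN1r -oppr_eq0 opprB em.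
Qed.

(** Clearing denominators turns the equation into [psi m = 0], solved by the intermediate value
    theorem between [m0] and [a^-1]. *)
Lemma te_equation_lt_half (a : R) : 0 < a < 2^-1 -> exists m, te_equation a m.
Proof.
move=> /andP[a0 a2].
pose psi (m : R) := expR m - 1 - m - a * (m * (expR m - 1)).
(* This choice gives [a * m0 ^+ 2 * expR m0 = m0 ^+ 2 / 2], exactly the quadratic term in the lower
   bound on [expR m0]. *)
pose m0 := ln (2 * a)^-1.
have m0E : expR m0 = (2 * a)^-1 by rewrite lnK// posrE invr_gt0; lra.
have m0_gt0 : 0 < m0 by rewrite ln_gt0// invf_gt1; lra.
have m01 : m0 <= a^-1.
  apply: le_trans (ltW (ln_sublinear _)) _; first by rewrite invr_gt0; lra.
  by rewrite lef_pV2 ?posrE; lra.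
have cpsi : {within `[m0, a^-1], continuous psi}.
  apply: continuous_subspaceT => z; apply: differentiable_continuous.
  by apply/derivable1_diffP; rewrite /psi.
have psi0 : 0 <= psi m0.
  have h1 := expR_ge_quadratic (ltW m0_gt0).
  have h2 : expR m0 - 1 <= m0 * expR m0.
    have := expR_ge1Dx (- m0); rewrite expRN => h.
    have e0 := expR_gt0 m0.
    have : expR m0 * (1 - m0) <= expR m0 * (expR m0)^-1 by rewrite ler_pM2l.
    by rewrite divff ?gt_eqF//; lra.
  have h3 : a * (m0 * (expR m0 - 1)) <= a * (m0 * (m0 * expR m0)).
    by rewrite ler_pM2l// ler_pM2l.
  have h4 : a * (m0 * (m0 * expR m0)) = m0 ^+ 2 / 2 by rewrite m0E; field; lra.
  by rewrite /psi; lra.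
have psi1 : psi a^-1 <= 0.
  rewrite /psi mulrA divff ?gt_eqF// mul1r.
  have : 0 < a^-1 by rewrite invr_gt0.
  lra.
have [|m] := IVT m01 cpsi (v := 0).
  by rewrite ge_min le_max psi0 psi1 orbT.
rewrite in_itv/= => /andP[m0m _] e.
have m_gt0 : 0 < m by exact: lt_le_trans m0m.
exists m; rewrite /te_equation gt_eqF//.
have em : 0 < expR m - 1 by rewrite subr_gt0 expR_gt1.
have ne : m * (expR m - 1) != 0 by rewrite mulf_neq0// gt_eqF.
apply: (mulIf ne); rewrite mulrBl mulKf ?gt_eqF// [_^-1 * _]mulrCA mulVf ?gt_eqF// mulr1.
by move: e; rewrite /psi; lra.
Qed.

Lemma te_parameterP (a : R) : 0 < a < 1 -> te_equation a (te_parameter a).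
Proof.
move=> /andP[a0 a1]; rewrite /te_parameter.
have [m am] : exists m, te_equation a m.
  have [ah|ah|ah] := ltgtP a 2^-1.
  - by apply: te_equation_lt_half; rewrite a0.
  - have [|m] := @te_equation_lt_half (1 - a); first by apply/andP; lra.
    by move=> /te_equation_opp; rewrite opprB addrC subrK; exists (- m).
  - by exists 0; rewrite /te_equation eqxx.
by case: xgetP => [y ->//|/(_ m)].
Qed.

(* [q] is the quantile function of the density [c * expR (- mu * x)] on
   [[0, 1]], and [M] a primitive of [x] times that density. *)
Section transport.
Variables (mu c a : R) (q M : R -> R).
Hypotheses (c0 : 0 < c)
  (dq : forall p : R, 0 <= p <= 1 -> is_derive p 1 q (expR (mu * q p) / c))
  (q0 : q 0 = 0) (q1 : q 1 = 1)
  (dM : forall s : R, is_derive s 1 M (s * c * expR (- (mu * s))))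
  (Ma : M 1 - M 0 = a).

Let t := q \o gauss_cdf.

Let dt (x : R) : is_derive x 1 t (gauss_pdf x * expR (mu * t x) / c).
Proof.
have /andP[/ltW p0 /ltW p1] := gauss_cdf_oo x.
have ? : is_derive (gauss_cdf x) 1 q (expR (mu * t x) / c).
  by apply: dq; rewrite p0 p1.
have ? := is_derive_gauss_cdf x.
by rewrite -mulrA mulrC; exact: is_derive1_comp.
Qed.

Let ct : continuous t.
Proof.
move=> x; have ? := dt x.
by apply: differentiable_continuous; apply/derivable1_diffP.
Qed.

Let t_lt : {homo t : x y / x < y}.
Proof.
apply: is_derive_gt0_lt dt _ => x.
by rewrite divr_gt0// mulr_gt0 ?gauss_pdf_gt0 ?expR_gt0.
Qed.

Let cq p : 0 <= p <= 1 -> {for p, continuous q}.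
Proof.
move=> /dq ?; apply: differentiable_continuous; exact/derivable1_diffP.
Qed.

Let tNy : t x @[x --> -oo] --> (0 : R).
Proof.
rewrite -q0; apply: (cvg_comp gauss_cdf q (normal_cdf_cvgNy 1)).
by apply: cq; rewrite lexx ler01.
Qed.

Let ty : t x @[x --> +oo] --> (1 : R).
Proof.
rewrite -q1; apply: (cvg_comp gauss_cdf q (normal_cdf_cvgy 1)).
by apply: cq; rewrite lexx ler01.
Qed.

Let t01 x : 0 <= t x <= 1.
Proof.
apply/andP; split.
- apply: (cvgr_to_le tNy); exists x; split; first exact: num_real.
  by move=> y yx; rewrite ltW// t_lt.
- apply: (cvgr_to_ge ty); exists x; split; first exact: num_real.
  by move=> y yx; rewrite ltW// t_lt.
Qed.

Let cM : continuous M.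
Proof. by move=> x; have ? := dM x; apply: differentiable_continuous; exact/derivable1_diffP. Qed.

(** The exponential factors of [M'] at [t x] and of the derivative of [t] cancel, so [M \o t] is a
    primitive of [t * gauss_pdf]. The mean is therefore the increment of [M] between the limits 0
    and 1 of [t]. *)
Lemma gauss_transport : [/\ forall x, 0 <= t x <= 1,
  forall x : R, is_derive x 1 t (gauss_pdf x * expR (mu * t x) / c) &
  (\int[normal_law 0 1]_x (t x)%:E = a%:E)%E].
Proof.
split => //.
rewrite ge0_integral_normal_law; last 2 first.
- by apply/measurable_EFinP; exact: continuous_measurable_fun.
- by move=> x; rewrite lee_fin; case/andP: (t01 x).
under eq_integral do rewrite -EFinM.
rewrite -Ma; apply: (@ge0_integral_FTC R (fun x => t x * gauss_pdf x) (M \o t)).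
- by move=> x; rewrite mulr_ge0//; [case/andP: (t01 x)|rewrite ltW// gauss_pdf_gt0].
- by move=> x; apply: cvgM; [exact: ct|exact: continuous_gauss_pdf].
- move=> x; have ? := dt x; have ? := dM (t x).
  apply: is_derive_eq; rewrite expRN; field.
  by rewrite gt_eqF//= gt_eqF// expR_gt0.
- by apply: (cvg_comp t M tNy); exact: cM.
- by apply: (cvg_comp t M ty); exact: cM.
Qed.
End transport.

(** The target density is [c * expR (- mu * x)], whose entropy, minus the mean of its logarithm, is
    [a * mu - ln c]. *)
Lemma truncated_exponential_transport (a : R) : 0 < a < 1 ->
  exists (t : R -> R) (mu c : R), [/\ 0 < c, forall x, 0 <= t x <= 1,
    forall x : R, is_derive x 1 t (gauss_pdf x * expR (mu * t x) / c),
    (\int[normal_law 0 1]_x (t x)%:E = a%:E)%E &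
    h_TE a = (a * mu - ln c)%:E].
Proof.
move=> a01; have := te_parameterP a01; rewrite /h_TE a01.
set mu := te_parameter a; rewrite /te_equation; case: eqVneq => [-> aE|mu0 aE].
  (* Parameter 0 is the uniform law, whose quantile function is the identity. *)
  have [||||||t01 dt ti] := @gauss_transport 0 1 a id (fun s => 2^-1 * (s * s)).
  - exact: ltr01.
  - by move=> p _; apply: is_derive_eq; rewrite mul0r expR0 divr1.
  - by [].
  - by [].
  - by move=> s; apply: is_derive_eq; rewrite mul0r oppr0 expR0 /GRing.scale/=; lra.
  - by rewrite aE; lra.
  exists (id \o gauss_cdf), 0, 1; split => //.
  by rewrite !mulr0 subr0 ln1 subrr.
pose k := 1 - expR (- mu).
have k0 : k != 0.
  by rewrite subr_eq0 eq_sym -[X in _ != X]expR0 (inj_eq (@expR_inj R)) oppr_eq0.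
have kmu : 0 < mu / k.
  have [m0|m0|/eqP] := ltgtP mu 0; last by rewrite (negbTE mu0).
  - by rewrite ltr_ndivlMr ?mul0r// /k subr_lt0 expR_gt1 oppr_gt0.
  - by rewrite divr_gt0// /k subr_gt0 expR_lt1 oppr_lt0.
have e1 : expR mu - 1 != 0 by rewrite subr_eq0 -[X in _ != X]expR0 (inj_eq (@expR_inj R)).
have e0 : expR mu != 0 by rewrite gt_eqF// expR_gt0.
have pk p : 0 <= p <= 1 -> 0 < 1 - p * k.
  move=> /andP[p0 p1]; have := expR_gt0 (- mu); rewrite /k.
  have [->|pn] := eqVneq p 1; first by lra.
  have : 0 <= p * expR (- mu) by rewrite mulr_ge0// expR_ge0.
  have : p < 1 by rewrite lt_neqAle pn.
  lra.
pose c := mu / k.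
(* Inverse of the distribution function [(1 - expR (- mu * x)) / k]. *)
pose q (p : R) := - mu^-1 * ln (1 - p * k).
pose M (s : R) := - c * (expR (- (mu * s)) * (s * mu^-1 + mu^-1 * mu^-1)).
have [||||||t01 dt ti] := @gauss_transport mu c a q M.
- by [].
- move=> p p01; have := pk p p01 => pk0.
  have ? := is_derive1_ln pk0.
  rewrite /q mulrA mulrN divff// mulN1r expRN lnK ?posrE//.
  have ? : is_derive p 1 (fun p : R => 1 - p * k) (- k).
    by apply: is_derive_eq; rewrite /GRing.scale/=; lra.
  have ? : is_derive p 1 (@ln R \o (fun p : R => 1 - p * k)) ((- k) * (1 - p * k)^-1).
    by rewrite mulrC; exact: is_derive1_comp.
  apply: (@is_derive_eq _ _ _ (fun p => - mu^-1 * (@ln R \o (fun p : R => 1 - p * k)) p)).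
  by rewrite /GRing.scale/= /c; field; rewrite k0 mu0 gt_eqF.
- by rewrite /q mul0r subr0 ln1 mulr0.
- by rewrite /q /k mul1r opprB addrC subrK expRK; field.
- move=> s; rewrite /M; have ? : is_derive s 1 (fun s => expR (- (mu * s))) (- mu * expR (- (mu * s))).
    by apply: is_derive_eq; rewrite /GRing.scale/=; lra.
  apply: is_derive_eq; rewrite /GRing.scale/=.
  by field.
- rewrite aE /M /c !mulr1 mulr0 oppr0 expR0 /k expRN; field.
  by rewrite e1 mu0 e0.
exists (q \o gauss_cdf), mu, c; split => //; congr (_%:E).
(* This identity turns the closed form defining [h_TE] into [a * mu - ln c]. *)
have -> : 1 - a * mu = c * expR (- mu).
  by rewrite aE /c /k expRN; field; rewrite ?e0 ?e1 ?mu0.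
rewrite lnM ?posrE// ?expR_gt0// expRK; lra.
Qed.

End truncated_exponential.

(** * The one-dimensional score *)

Section posterior_bound.
Context {R : realType}.

(** Both exponentials lie above the tangent line at the weighted mean [m], and the linear terms
    cancel in the weighted sum. *)
Lemma expR_weighted_AMGM (p q u v : R) : 0 <= p -> 0 <= q -> p + q = 1 ->
  expR (p * u + q * v) <= p * expR u + q * expR v.
Proof.
move=> p0 q0 pq; set m := p * u + q * v.
have hu : expR m * (1 + (u - m)) <= expR u.
  have -> : expR u = expR m * expR (u - m) by rewrite -expRD addrC subrK.
  by rewrite ler_pM2l ?expR_gt0// expR_ge1Dx.
have hv : expR m * (1 + (v - m)) <= expR v.
  have -> : expR v = expR m * expR (v - m) by rewrite -expRD addrC subrK.
  by rewrite ler_pM2l ?expR_gt0// expR_ge1Dx.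
apply: (@le_trans _ _ (p * (expR m * (1 + (u - m))) + q * (expR m * (1 + (v - m))))).
  rewrite le_eqVlt; apply/orP; left; apply/eqP.
  transitivity (expR m * ((p + q) * (1 - m) + m)); last by rewrite /m; ring.
  by rewrite pq; ring.
by rewrite lerD// ler_wpM2l.
Qed.

(* A lower bound, exact up to AM-GM, on the log of [gauss_pdf y * dy/dx] over
   [gauss_pdf x], where [y = a * x - b * z] and [v = t x]. *)
Definition score (a b C mu v x z : R) : R :=
  C + b ^+ 2 * (mu * v - z ^+ 2 / 2) + a * b * (x * z).

Definition score_const (a b l c : R) : R :=
  - (a ^+ 2 * ln a) + b ^+ 2 * (ln l + ln (normal_peak 1) - ln c - ln b).

(* [y] is the rotation of [(x, z)] by the angle with cosine [a] and sine [b];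
   along the fibre of a fixed channel output it is an increasing function of
   [x], so the standard normal density of [y] times [dy/dx] integrates to at
   most 1. *)
Lemma score_bound (a b l mu c u : R) (t : R -> R) :
  0 < a -> 0 < b -> a ^+ 2 + b ^+ 2 = 1 -> 0 < l -> 0 < c ->
  (forall x : R, is_derive x 1 t (gauss_pdf x * expR (mu * t x) / c)) ->
  (\int[normal_law 0 1]_x
    (expR (score a b (score_const a b l c) mu (t x) x (u - l * t x)))%:E <= 1)%E.
Proof.
move=> a0 b0 ab l0 c0 dt.
set C := score_const a b l c.
pose dy x := a + b * (l * (gauss_pdf x * expR (mu * t x) / c)).
pose y x := a * x - b * (u - l * t x).
have dyE (x : R) : is_derive x 1 y (dy x).
  by have ? := dt x; apply: is_derive_eq; rewrite /dy /GRing.scale/=; ring.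
have ct : continuous t.
  by move=> x; apply: differentiable_continuous; exact/derivable1_diffP.
have cy : continuous y.
  by move=> x; apply: differentiable_continuous; exact/derivable1_diffP.
have cdy : continuous dy.
  move=> x; apply: cvgD; first exact: cvg_cst.
  apply: cvgM; first exact: cvg_cst.
  apply: cvgM; first exact: cvg_cst.
  apply: cvgM; last exact: cvg_cst.
  apply: cvgM; first exact: continuous_gauss_pdf.
  apply: (cvg_comp (fun x => mu * t x) expR); last exact: continuous_expR.
  by apply: cvgM; [exact: cvg_cst|exact: ct].
have dy_ge0 x : 0 <= dy x.
  by rewrite addr_ge0 ?ltW// !mulr_gt0 ?gauss_pdf_gt0 ?expR_gt0 ?invr_gt0.
have mt : measurable_fun [set: R] t by exact: continuous_measurable_fun.
have cpdf : continuous (fun x => gauss_pdf (y x) * dy x).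
  move=> x; apply: cvgM; last exact: cdy.
  by apply: (cvg_comp y gauss_pdf); [exact: cy|exact: continuous_gauss_pdf].
have mS : measurable_fun [set: R]
    (fun x => expR (score a b C mu (t x) x (u - l * t x))).
  apply: measurableT_comp => //; rewrite /score.
  have mz : measurable_fun [set: R] (fun x => u - l * t x).
    by apply: measurable_funB => //; exact: measurable_funM.
  apply: measurable_funD; last by apply: measurable_funM => //; exact: measurable_funM.
  apply: measurable_funD => //; apply: measurable_funM => //.
  apply: measurable_funB; first exact: measurable_funM.
  by apply: measurable_funM => //; exact: measurable_funX.
rewrite ge0_integral_normal_law; last 2 first.
- exact/measurable_EFinP.
- by move=> x; rewrite lee_fin expR_ge0.
(* The primitive [gauss_cdf \o y] takes values between 0 and 1, so its increments are at most 1. *)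
have := @ge0_integral_FTC_le R (fun x => gauss_pdf (y x) * dy x) (gauss_cdf \o y) 1.
move=> /(_ _ cpdf) h; apply: le_trans (h _ _ _).
- apply: ge0_le_integral => //.
  + by move=> x _; rewrite mule_ge0// lee_fin ?expR_ge0// normal_pdf_ge0.
  + apply: emeasurable_funM; apply/measurable_EFinP => //.
    exact: measurable_normal_pdf.
  + by apply/measurable_EFinP; exact: continuous_measurable_fun.
  + move=> x _; rewrite -EFinM lee_fin -/gauss_pdf -/(gauss_pdf x).
    (* [w] is the logarithm of [l] times the derivative of [t]. Writing [dy] as
       [a ^+ 2 * a^-1 + b ^+ 2 * (expR w / b)] makes the AM-GM weights sum to 1. *)
    pose w := ln l + ln (normal_peak 1) - x ^+ 2 / 2 + mu * t x - ln c.
    have dyw : expR (a ^+ 2 * - ln a + b ^+ 2 * (w - ln b)) <= dy x.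
      apply: le_trans (expR_weighted_AMGM _ _ _ _ ab) _; rewrite ?sqr_ge0//.
      have pk : 0 < normal_peak 1 :> R by rewrite normal_peak_gt0// oner_eq0.
      rewrite expRN lnK ?posrE// /w !expRD !expRN !lnK ?posrE//.
      rewrite /dy gauss_pdfE mulNr expRN le_eqVlt; apply/orP; left; apply/eqP.
      by field; rewrite !gt_eqF// expR_gt0.
    apply: le_trans (ler_wpM2l (ltW (gauss_pdf_gt0 (y x))) dyw).
    rewrite !gauss_pdfE mulrCA -!mulrA ler_pM2l ?normal_peak_gt0 ?oner_eq0//.
    rewrite -!expRD ler_expR le_eqVlt -subr_eq0; apply/orP; left; apply/eqP.
    (* The two exponents agree up to a multiple of [a ^+ 2 + b ^+ 2 - 1]. *)
    transitivity ((a ^+ 2 + b ^+ 2 - 1) * (x ^+ 2 / 2)).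
      by rewrite /score /C /score_const /w /y; field.
    by rewrite ab subrr mul0r.
- by move=> x; rewrite mulr_ge0// ltW// gauss_pdf_gt0.
- move=> x; have ? := dyE x; have ? := is_derive_gauss_cdf (y x).
  exact: is_derive1_comp.
- move=> x x' /=; have /andP[h0 h1] := gauss_cdf_itv (y x).
  by have /andP[h2 h3] := gauss_cdf_itv (y x'); lra.
Qed.

End posterior_bound.

(** * Expectations under product laws *)

Section has_mean.
Context {R : realType}.

(** Integrability is bundled with the value so that sums, multiples and independent products can be
    chained without side conditions. *)
Definition has_mean d (T : measurableType d) (P : probability T R) (f : T -> R) (v : R) :=
  P.-integrable [set: T] (EFin \o f) /\ (\int[P]_x (f x)%:E = v%:E)%E.

Section one_law.
Context d (T : measurableType d) (P : probability T R).

Lemma has_mean_measurable f v : has_mean P f v -> measurable_fun [set: T] f.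
Proof. by move=> [/measurable_int/measurable_EFinP]. Qed.

Lemma has_mean_cst v : has_mean P (cst v) v.
Proof.
split; first exact: finite_measure_integrable_cst.
by have := integral_cst P measurableT v%:E; rewrite /= probability_setT mule1.
Qed.

Lemma has_meanD f g v w :
  has_mean P f v -> has_mean P g w -> has_mean P (f \+ g) (v + w).
Proof.
move=> [intf fv] [intg gw]; split.
  by rewrite (_ : _ \o _ = (EFin \o f) \+ (EFin \o g))%E//; exact: integrableD.
by rewrite EFinD -fv -gw; exact: integralD_EFin.
Qed.

Lemma has_meanZ f v k : has_mean P f v -> has_mean P (fun x => k * f x) (k * v).
Proof.
move=> [intf fv]; split.
  rewrite (_ : _ \o _ = fun x => (k%:E * (EFin \o f) x)%E)//.
  exact: integrableZl.
by rewrite EFinM -fv -integralZl.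
Qed.

Lemma has_mean_sum (I : Type) (r : seq I) (f : I -> T -> R) (v : I -> R) :
  (forall i, has_mean P (f i) (v i)) ->
  has_mean P (fun x => \sum_(i <- r) f i x) (\sum_(i <- r) v i).
Proof.
move=> fv; elim: r => [|i r IH].
  rewrite big_nil (_ : (fun x => _) = cst 0); first exact: has_mean_cst.
  by apply/funext => x; rewrite big_nil.
rewrite big_cons (_ : (fun x => _) = f i \+ (fun x => \sum_(j <- r) f j x)).
  exact: has_meanD.
by apply/funext => x; rewrite big_cons.
Qed.

Lemma has_mean_bounded (f : T -> R) (c : R) : measurable_fun [set: T] f ->
  (forall x, `|f x| <= c) -> exists v, has_mean P f v.
Proof.
move=> mf fc.
have intf : P.-integrable [set: T] (EFin \o f).
  apply: (@le_integrable _ _ _ P _ measurableT _ (EFin \o cst c)).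
  - exact/measurable_EFinP.
  - by move=> x _ /=; rewrite lee_fin (le_trans (fc x))// ler_norm.
  - exact: finite_measure_integrable_cst.
exists (fine (\int[P]_x (f x)%:E)%E); split => //.
by rewrite fineK//; exact: integrable_fin_num.
Qed.

Lemma has_mean_distribution d' (T' : measurableType d') (X : {mfun T >-> T'})
    (f : T' -> R) v : measurable_fun [set: T'] f ->
  has_mean P (f \o X) v -> has_mean (distribution P X) f v.
Proof.
move=> mf [intf fv]; have mEf : measurable_fun [set: T'] (EFin \o f).
  exact/measurable_EFinP.
split; last by rewrite -fv integral_distribution.
exact: integrable_pushforward.
Qed.

End one_law.

(** Independence: integrability follows from iterated integrals of absolute values, and the value
    from Fubini's theorem. *)
Lemma has_mean_prodM d1 d2 (T1 : measurableType d1) (T2 : measurableType d2)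
    (P1 : probability T1 R) (P2 : probability T2 R) f g v w :
  has_mean P1 f v -> has_mean P2 g w ->
  has_mean (P1 \x P2)%E (fun u => f u.1 * g u.2) (v * w).
Proof.
move=> fv gw; have mf := has_mean_measurable fv; have mg := has_mean_measurable gw.
case: fv gw => [intf fv] [intg gw].
have mfg : measurable_fun [set: T1 * T2] (EFin \o (fun u => f u.1 * g u.2)).
  apply/measurable_EFinP; apply: measurable_funM.
    by apply: measurableT_comp => //; exact: measurable_fst.
  by apply: measurableT_comp => //; exact: measurable_snd.
have intfg : (P1 \x P2)%E.-integrable [set: T1 * T2] (EFin \o (fun u => f u.1 * g u.2)).
  apply/(@integrable12ltyP _ _ _ _ _ P1 P2 _ mfg).
  have intag := integrable_abse intg.
  under eq_integral => x _.
    under eq_integral => y _ do rewrite /= normrM EFinM.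
    rewrite (integralZl measurableT intag); over.
  have gfin : (\int[P2]_y `|(g y)%:E| \is a fin_num)%E.
    by have := integrable_fin_num measurableT intag.
  rewrite /= -(fineK gfin).
  under eq_integral do rewrite muleC.
  rewrite (integralZl measurableT (integrable_abse intf)).
  apply: lte_mul_pinfty; rewrite ?fineK//.
    by apply: integral_ge0.
  by have /integrableP[] := intf.
split=> //; rewrite -(integral12_prod_meas1 intfg) /fubini_F /=.
under eq_integral => x _.
  under eq_integral => y _ do rewrite EFinM.
  rewrite (integralZl measurableT intg) gw muleC; over.
by rewrite (integralZl measurableT intf) fv -EFinM mulrC.
Qed.

Lemma has_mean_fst d1 d2 (T1 : measurableType d1) (T2 : measurableType d2)
    (P1 : probability T1 R) (P2 : probability T2 R) f v :
  has_mean P1 f v -> has_mean (P1 \x P2)%E (fun u => f u.1) v.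
Proof.
move=> /has_mean_prodM/(_ (has_mean_cst P2 1)); rewrite mulr1.
by rewrite (_ : (fun u => _) = fun u : T1 * T2 => f u.1)//; apply/funext => u; rewrite mulr1.
Qed.

Lemma has_mean_snd d1 d2 (T1 : measurableType d1) (T2 : measurableType d2)
    (P1 : probability T1 R) (P2 : probability T2 R) g w :
  has_mean P2 g w -> has_mean (P1 \x P2)%E (fun u => g u.2) w.
Proof.
move=> /(has_mean_prodM (has_mean_cst P1 1)); rewrite mul1r.
by rewrite (_ : (fun u => _) = fun u : T1 * T2 => g u.2)//; apply/funext => u; rewrite mul1r.
Qed.

Lemma tnth_tuple_cons0 n (x : R) (xs : n.-tuple R) : tnth (tuple_cons (x, xs)) ord0 = x.
Proof. by rewrite (tnth_nth 0). Qed.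

Lemma tnth_tuple_consS n (x : R) (xs : n.-tuple R) i :
  tnth (tuple_cons (x, xs)) (lift ord0 i) = tnth xs i.
Proof. by rewrite !(tnth_nth 0). Qed.

Lemma has_mean_tnth (P : probability R R) n (i : 'I_n) (f : R -> R) v :
  has_mean P f v -> has_mean (iid_law P n) (fun x => f (tnth x i)) v.
Proof.
move=> fv; have mf := has_mean_measurable fv.
elim: n i => [[]//|n IH i].
apply: has_mean_distribution.
  by apply: (measurableT_comp mf); exact: measurable_tnth.
case: (unliftP ord0 i) => [j|] ->.
- rewrite (_ : _ \o _ = fun u : R * n.-tuple R => f (tnth u.2 j)).
    exact: (@has_mean_snd _ _ _ _ P (iid_law P n) (fun xs => f (tnth xs j)) v (IH j)).
  by apply/funext => -[x xs] /=; rewrite tnth_tuple_consS.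
- rewrite (_ : _ \o _ = fun u : R * n.-tuple R => f u.1); first exact: has_mean_fst.
  by apply/funext => -[x xs] /=; rewrite tnth_tuple_cons0.
Qed.

Lemma has_mean_tnthM (P : probability R R) n (i j : 'I_n) (f g : R -> R) v w : i != j ->
  has_mean P f v -> has_mean P g w ->
  has_mean (iid_law P n) (fun x => f (tnth x i) * g (tnth x j)) (v * w).
Proof.
move=> ij fv gw; have mf := has_mean_measurable fv; have mg := has_mean_measurable gw.
elim: n i j ij => [[]//|n IH i j ij].
apply: has_mean_distribution.
  by apply: measurable_funM; [apply: (measurableT_comp mf)|apply: (measurableT_comp mg)];
    exact: measurable_tnth.
case: (unliftP ord0 i) ij => [i'|] ->; case: (unliftP ord0 j) => [j'|] -> ij.
- rewrite (_ : _ \o _ = fun u : R * n.-tuple R => f (tnth u.2 i') * g (tnth u.2 j')).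
    have ij' : i' != j' by apply: contra ij => /eqP ->.
    exact: (@has_mean_snd _ _ _ _ P (iid_law P n)
      (fun xs => f (tnth xs i') * g (tnth xs j')) (v * w) (IH _ _ ij')).
  by apply/funext => -[x xs] /=; rewrite !tnth_tuple_consS.
- rewrite mulrC (_ : _ \o _ = fun u : R * n.-tuple R => g u.1 * f (tnth u.2 i')).
    exact: (@has_mean_prodM _ _ _ _ P (iid_law P n) g (fun xs => f (tnth xs i')) w v gw (has_mean_tnth _ fv)).
  by apply/funext => -[x xs] /=; rewrite tnth_tuple_consS tnth_tuple_cons0 mulrC.
- rewrite (_ : _ \o _ = fun u : R * n.-tuple R => f u.1 * g (tnth u.2 j')).
    exact: (@has_mean_prodM _ _ _ _ P (iid_law P n) f (fun xs => g (tnth xs j')) v w fv (has_mean_tnth _ gw)).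
  by apply/funext => -[x xs] /=; rewrite tnth_tuple_consS tnth_tuple_cons0.
- by rewrite eqxx in ij.
Qed.

(* Only the coordinates after the [i]-th enter the parameter [s i], so
   integrating out the first coordinate removes exactly one factor. *)
Lemma triangular_integral_le1 (P : probability R R) n (K : 'I_n -> R -> R -> R)
    (s : 'I_n -> n.-tuple R -> R) :
  (forall i x u, 0 <= K i x u) ->
  (forall i, measurable_fun [set: R * R] (fun p => K i p.1 p.2)) ->
  (forall i, measurable_fun [set: n.-tuple R] (s i)) ->
  (forall (i : 'I_n) (x y : n.-tuple R),
    (forall j : 'I_n, (i < j)%N -> tnth x j = tnth y j) -> s i x = s i y) ->
  (forall i u, \int[P]_x (K i x u)%:E <= 1)%E ->
  (\int[iid_law P n]_x (\prod_i K i (tnth x i) (s i x))%:E <= 1)%E.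
Proof.
elim: n K s => [|n IH] K s K0 mK ms sdep K1.
  under eq_integral do rewrite big_ord0.
  by have := integral_cst (iid_law P 0) measurableT 1%E; rewrite /= probability_setT mule1 => ->.
have mF : measurable_fun [set: n.+1.-tuple R]
    (fun x => \prod_i K i (tnth x i) (s i x)).
  apply: measurable_prod => i _.
  apply: (measurableT_comp (mK i) (g := fun x => (tnth x i, s i x))).
  by apply: measurable_fun_pair => //; exact: measurable_tnth.
rewrite ge0_integral_distribution; last 2 first.
- exact/measurable_EFinP.
- by move=> x; rewrite lee_fin prodr_ge0.
(* No parameter depends on the first coordinate, so it may be filled with 0. *)
pose s' i (xs : n.-tuple R) := s i (tuple_cons (0, xs)).
have s'E i x xs : s i (tuple_cons (x, xs)) = s' i xs.
  apply: sdep => j; case: (unliftP ord0 j) => [j'|] -> //.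
  by rewrite !tnth_tuple_consS.
have mcons : measurable_fun [set: n.-tuple R] (fun xs => tuple_cons (0, xs)).
  apply: (measurableT_comp (f := @tuple_cons R n) (g := fun xs => (0, xs))).
    exact: measurable_funPT.
  by apply: measurable_fun_pair.
have ms' i : measurable_fun [set: n.-tuple R] (s' i).
  exact: (measurableT_comp (ms i)).
have mP' : measurable_fun [set: n.-tuple R]
    (fun xs => \prod_i K (lift ord0 i) (tnth xs i) (s' (lift ord0 i) xs)).
  apply: measurable_prod => i _.
  apply: (measurableT_comp (mK _) (g := fun x => (tnth x i, s' _ x))).
  by apply: measurable_fun_pair => //; exact: measurable_tnth.
have consE x xs : \prod_i K i (tnth (tuple_cons (x, xs)) i) (s i (tuple_cons (x, xs))) =
    K ord0 x (s' ord0 xs) * \prod_i K (lift ord0 i) (tnth xs i) (s' (lift ord0 i) xs).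
  rewrite big_ord_recl tnth_tuple_cons0 s'E; congr (_ * _).
  by apply: eq_bigr => i _; rewrite tnth_tuple_consS s'E.
pose G u := (\prod_i K i (tnth (tuple_cons u) i) (s i (tuple_cons u)))%:E.
have mG : measurable_fun [set: R * n.-tuple R] G.
  apply/measurable_EFinP; apply: (measurableT_comp mF (g := @tuple_cons R n)).
  exact: measurable_funPT.
have G0 u : (0 <= G u)%E by rewrite lee_fin prodr_ge0.
(* The first coordinate is integrated innermost, with all later ones fixed. *)
rewrite (fubini_tonelli2 (m1 := P) (m2 := iid_law P n) G)//.
rewrite /fubini_G /=.
have mK0 xs : measurable_fun [set: R] (fun x => K ord0 x (s' ord0 xs)).
  by apply: (measurableT_comp (mK ord0) (g := fun x => (x, s' ord0 xs))).
apply: le_trans (IH (fun i => K (lift ord0 i)) (fun i => s' (lift ord0 i)) _ _ _ _ _) => //.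
- apply: ge0_le_integral => //.
  + by move=> xs _; apply: integral_ge0 => x _; rewrite lee_fin prodr_ge0.
  + exact: (measurable_fun_fubini_tonelli_G (m1 := P) G).
  + exact/measurable_EFinP.
  + move=> xs _; rewrite /G; under eq_integral do rewrite consE EFinM muleC.
    rewrite ge0_integralZl//.
    * by rewrite -[leRHS]mule1 lee_wpmul2l// lee_fin prodr_ge0.
    * exact/measurable_EFinP.
    * by move=> x _; rewrite lee_fin.
    * by rewrite lee_fin prodr_ge0.
- move=> i xs ys xy; apply: sdep => j; case: (unliftP ord0 j) => [j'|] -> //.
  by rewrite !tnth_tuple_consS => ij; apply: xy.
Qed.

End has_mean.

(** * Moments of Gaussian vectors *)

Section normal_moments.
Context {R : realType}.
Variable s : R.
Hypothesis s0 : s != 0.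
Notation mu := (@lebesgue_measure R).

Let pdf : R -> R := normal_pdf 0 s.

Let pdfE x : pdf x = normal_peak s * expR (- (x ^+ 2) / (s ^+ 2 *+ 2)).
Proof. by rewrite /pdf normal_pdfE// /normal_fun subr0. Qed.

Let pdfN x : pdf (- x) = pdf x.
Proof. by rewrite !pdfE sqrrN. Qed.

Let dpdf (x : R) : is_derive x 1 pdf (- (x / s ^+ 2) * pdf x).
Proof.
rewrite (_ : pdf = fun x => normal_peak s * expR (- (2 * s ^+ 2)^-1 * (x * x))); last first.
  apply/funext => y; rewrite pdfE -mulr_natr; congr (_ * expR _).
  by field.
apply: is_derive_eq; rewrite /GRing.scale/=; field.
by [].
Qed.

Let cpdf : continuous pdf.
Proof. exact: continuous_normal_pdf. Qed.

(** Primitive of [x ^+ 2 * pdf x], obtained by parts. *)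
Let F x := - (s ^+ 2) * (x * pdf x) + s ^+ 2 * normal_cdf s x.

Let dF (x : R) : is_derive x 1 F (x ^+ 2 * pdf x).
Proof.
have ? := dpdf x; have ? := is_derive_normal_cdf s0 x.
by apply: is_derive_eq; rewrite /GRing.scale/= -/pdf; field.
Qed.

Let G x := F x + - (2 * s ^+ 2) * pdf x + normal_cdf s x.

Let dG (x : R) : is_derive x 1 G ((x + 1) ^+ 2 * pdf x).
Proof.
have ? := dpdf x; have ? := is_derive_normal_cdf s0 x; have ? := dF x.
by apply: is_derive_eq; rewrite /GRing.scale/= -/pdf; field.
Qed.

Let cdf (x : R) := is_derive_normal_cdf s0 x.

Let cvg2 : (F n%:R - F (- n%:R))%:E @[n --> \oo] --> (\int[mu]_x (x ^+ 2 * pdf x)%:E)%E.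
Proof.
apply: ge0_integral_FTC_cvg dF.
- by move=> x; rewrite mulr_ge0 ?sqr_ge0// normal_pdf_ge0.
- by move=> x; apply: cvgM; [exact: exprn_continuous|exact: cpdf].
Qed.

Let cvg0 : (normal_cdf s n%:R - normal_cdf s (- n%:R))%:E @[n --> \oo] --> 1%E.
Proof.
rewrite -(integral_normal_pdf 0 s).
by apply: ge0_integral_FTC_cvg cdf => //; move=> x; exact: normal_pdf_ge0.
Qed.

Let int2_le : (\int[mu]_x (x ^+ 2 * pdf x)%:E <= (s ^+ 2)%:E)%E.
Proof.
rewrite -(cvg_lim _ cvg2)//; apply: lime_le; first by apply/cvg_ex; eexists; exact: cvg2.
apply: nearW => n; rewrite lee_fin /F pdfN.
have /andP[h0 h1] := normal_cdf_itv s n%:R; have /andP[h2 h3] := normal_cdf_itv s (- n%:R).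
have : 0 <= s ^+ 2 * (n%:R * pdf n%:R).
  by rewrite mulr_ge0 ?sqr_ge0// mulr_ge0// normal_pdf_ge0.
have : s ^+ 2 * (normal_cdf s n%:R - normal_cdf s (- n%:R)) <= s ^+ 2 * 1.
  by rewrite ler_wpM2l ?sqr_ge0//; lra.
lra.
Qed.

Let sqr_pdf (f : R -> R) : measurable_fun [set: R] f ->
  (\int[normal_law 0 s]_x ((f x) ^+ 2)%:E = \int[mu]_x (f x ^+ 2 * pdf x)%:E)%E.
Proof.
move=> mf; rewrite ge0_integral_normal_law; last 2 first.
- by apply/measurable_EFinP; exact: measurable_funX.
- by move=> x; rewrite lee_fin sqr_ge0.
by apply: eq_integral => x _; rewrite EFinM.
Qed.

Lemma has_mean_sqr_normal :
  exists2 v, v <= s ^+ 2 & has_mean (normal_law 0 s) (fun x => x ^+ 2) v.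
Proof.
have i2 := sqr_pdf (@measurable_id _ R setT).
have lt2 : (\int[normal_law 0 s]_x (x ^+ 2)%:E < +oo)%E.
  by rewrite i2; exact: le_lt_trans int2_le (ltry _).
have fin2 : (\int[normal_law 0 s]_x (x ^+ 2)%:E)%E \is a fin_num.
  by rewrite ge0_fin_numE// integral_ge0// => x _; rewrite lee_fin sqr_ge0.
exists (fine (\int[normal_law 0 s]_x (x ^+ 2)%:E)%E).
  by rewrite -lee_fin fineK// i2.
split; last by rewrite fineK.
apply/integrableP; split; first by apply/measurable_EFinP; exact: exprn_measurable.
by under eq_integral do rewrite /= ger0_norm ?sqr_ge0//.
Qed.

(* The density is even, so it drops out of the primitive of [(x + 1) ^+ 2 * pdf x]
   between [-n] and [n]: hence E[(X + 1)^2] = E[X^2] + 1. *)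
Lemma has_mean_id_normal : has_mean (normal_law 0 s) id 0.
Proof.
have [v _ v2] := has_mean_sqr_normal.
have h1 : has_mean (normal_law 0 s) (cst 1 \+ (fun x => x ^+ 2)) (1 + v).
  exact: has_meanD (has_mean_cst _ _) v2.
have intx : (normal_law 0 s).-integrable [set: R] (EFin \o id).
  apply: (@le_integrable _ _ _ (normal_law 0 s) _ measurableT _ _ _ _ h1.1).
    exact/measurable_EFinP.
  move=> x _ /=; rewrite lee_fin [leRHS]ger0_norm; last by rewrite addr_ge0// sqr_ge0.
  by rewrite ler_norml; apply/andP; split; nra.
have [w hw] : exists w, has_mean (normal_law 0 s) id w.
  exists (fine (\int[normal_law 0 s]_x x%:E)%E); split => //.
  by rewrite fineK//; exact: integrable_fin_num.
have hG : (\int[normal_law 0 s]_x ((x + 1) ^+ 2)%:E = (v + 1)%:E)%E.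
  rewrite (sqr_pdf (f := fun x => x + 1)); last exact: measurable_funD.
  have cvgG : (G n%:R - G (- n%:R))%:E @[n --> \oo] -->
      (\int[mu]_x ((x + 1) ^+ 2 * pdf x)%:E)%E.
    apply: ge0_integral_FTC_cvg dG.
    - by move=> x; rewrite mulr_ge0 ?sqr_ge0// normal_pdf_ge0.
    - move=> x; apply: cvgM; last exact: cpdf.
      apply: (cvg_comp (fun x => x + 1) (fun x => x ^+ 2)); last exact: exprn_continuous.
      by apply: cvgD; [exact: cvg_id|exact: cvg_cst].
  have : (G n%:R - G (- n%:R))%:E @[n --> \oo] --> (v + 1)%:E.
    rewrite (_ : (fun n => _) = fun n : nat => ((F n%:R - F (- n%:R))%:E +
        (normal_cdf s n%:R - normal_cdf s (- n%:R))%:E)%E); last first.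
      by apply/funext => n; rewrite -EFinD /G pdfN; congr (_%:E); ring.
    rewrite EFinD; apply: cvgeD => //.
    by rewrite -v2.2 (sqr_pdf (@measurable_id _ R setT)).
  by move=> h; rewrite -(cvg_lim _ cvgG)// (cvg_lim _ h).
have h2 : has_mean (normal_law 0 s) (fun x => 2 * x) (2 * w) := has_meanZ 2 hw.
have [_] := has_meanD h1 h2.
under eq_integral => x _.
  rewrite (_ : _ x = (x + 1) ^+ 2); last by rewrite /=; ring.
  over.
(* Expanding the square gives [1 + v + 2 * w], to be compared with [v + 1]. *)
rewrite hG => -[e]; have : w = 0 by lra.
by move=> w0; move: hw; rewrite w0.
Qed.

End normal_moments.

Section gaussian_linear_forms.
Context {R : realType}.
Variables (s : R) (n : nat) (w : 'I_n -> R).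
Hypothesis s0 : s != 0.

Definition linear_form (z : n.-tuple R) : R := \sum_k w k * tnth z k.

Lemma has_mean_linear_form : has_mean (gaussian_law s n) linear_form 0.
Proof.
have := @has_mean_sum R _ _ (gaussian_law s n) _ (index_enum 'I_n)
  (fun k z => w k * tnth z k) (fun k => w k * 0).
rewrite (_ : \sum_(k <- _) w k * 0 = 0).
  by apply=> k; apply: has_meanZ; exact: (has_mean_tnth k (has_mean_id_normal s0)).
by rewrite big1// => k _; rewrite mulr0.
Qed.

(** The square expands into a double sum whose off-diagonal terms vanish by independence and
    centring. *)
Lemma has_mean_sqr_linear_form :
  exists2 v, v <= s ^+ 2 * \sum_k w k ^+ 2 &
    has_mean (gaussian_law s n) (fun z => linear_form z ^+ 2) v.
Proof.
have [v vs hv] := has_mean_sqr_normal s0.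
have id0 := has_mean_id_normal s0.
exists (\sum_k \sum_l (w k * w l) * (if k == l then v else 0)).
  rewrite mulr_sumr; apply: ler_sum => k _.
  rewrite (bigD1 k)//= eqxx big1 ?addr0; last first.
    by move=> l /negbTE; rewrite eq_sym => ->; rewrite mulr0.
  by rewrite -expr2 mulrC ler_wpM2r// sqr_ge0.
rewrite (_ : (fun z => _) =
    fun z : n.-tuple R => \sum_k \sum_l (w k * w l) * (tnth z k * tnth z l)).
  apply: has_mean_sum => k; apply: has_mean_sum => l; apply: has_meanZ.
  case: eqVneq => [<-|kl]; first exact: (has_mean_tnth k hv).
  by rewrite -(mulr0 0); exact: (has_mean_tnthM kl id0 id0).
apply/funext => z; rewrite expr2 /linear_form mulr_suml; apply: eq_bigr => k _.
by rewrite mulr_sumr; apply: eq_bigr => l _; ring.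
Qed.

End gaussian_linear_forms.

(** * Push-forward of one factor of a product law *)

Section product_pushforward.
Context {R : realType} d1 d2 d3 (T1 : measurableType d1) (T2 : measurableType d2)
  (T3 : measurableType d3).
Variables (P : probability T1 R) (Q : probability T3 R) (phi : {mfun T1 >-> T2}).

(** The change of variables holds for nonnegative functions by Tonelli's theorem, then for [f]
    through its positive and negative parts. *)
Lemma has_mean_prod_distribution (f : T2 * T3 -> R) v :
  measurable_fun [set: T2 * T3] f ->
  has_mean (P \x Q)%E (fun u => f (phi u.1, u.2)) v ->
  has_mean (distribution P phi \x Q)%E f v.
Proof.
move=> mf [intf fv].
have mphi := @measurable_funPT _ _ _ _ phi.
have ge0E (g : T2 * T3 -> \bar R) : measurable_fun [set: T2 * T3] g ->
    (forall x, 0 <= g x)%E ->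
    (\int[(distribution P phi \x Q)%E]_u g u =
     \int[(P \x Q)%E]_u g (phi u.1, u.2))%E.
  move=> mg g0.
  have mg' : measurable_fun [set: T1 * T3] (fun u => g (phi u.1, u.2)).
    apply: (measurableT_comp mg (g := fun u => (phi u.1, u.2))).
    apply: measurable_fun_pair => //.
    by apply: (measurableT_comp mphi); exact: measurable_fst.
  rewrite (fubini_tonelli1 (m1 := distribution P phi) (m2 := Q) g)//.
  rewrite (fubini_tonelli1 (m1 := P) (m2 := Q) (fun u => g (phi u.1, u.2)))//.
  rewrite ge0_integral_distribution//.
  - exact: (measurable_fun_fubini_tonelli_F (m2 := Q) g).
  - by move=> x; apply: integral_ge0.
have mEf : measurable_fun [set: T2 * T3] (EFin \o f) by exact/measurable_EFinP.
split.
  apply/integrableP; split => //.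
  rewrite ge0E//; last exact: measurableT_comp.
  by have /integrableP[] := intf.
rewrite integralE ge0E//; last exact: (measurable_funepos mEf).
rewrite ge0E//; last exact: (measurable_funeneg mEf).
rewrite -fv [RHS]integralE.
by congr (_ - _)%E; apply: eq_integral => u _; rewrite unlock.
Qed.

End product_pushforward.

(** * Measurable inverse of an increasing map *)

Section measurable_left_inverse.
Context {R : realType}.

(* The logistic map turns the supremum defining a generalised inverse into a
   bounded monotone function. *)
Lemma measurable_left_inverse (t : R -> R) : {homo t : x y / x < y} ->
  exists2 T : R -> R, measurable_fun [set: R] T & cancel t T.
Proof.
move=> t_lt.
pose g (y : R) := (1 + expR (- y))^-1.
have e0 y : 0 < 1 + expR (- y) by rewrite addr_gt0// expR_gt0.
have g0 y : 0 < g y by rewrite invr_gt0.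
have g1 y : g y <= 1 by rewrite invf_le1// lerDl expR_ge0.
have g_le : {homo g : x y / x <= y}.
  by move=> x y xy; rewrite lef_pV2 ?posrE// lerD2l ler_expR lerN2.
(* Adjoining 0 keeps the set nonempty when [v] lies below the range of [t]. *)
pose S v : set R := [set z | z = 0 \/ exists2 y, t y <= v & z = g y].
have Sub v : has_ubound (S v).
  by exists 1 => _ [->|[y _ ->]].
have S0 v : S v !=set0 by exists 0; left.
pose A v := sup (S v).
have A_le : nondecreasing_fun A.
  move=> v w vw; apply: ge_sup => // z Sz; apply: ub_le_sup => //.
  by case: Sz => [->|[y yv ->]]; [left|right; exists y => //; exact: le_trans vw].
have mA : measurable_fun [set: R] A by exact: nondecreasing_measurable.
have At x : A (t x) = g x.
  apply/eqP; rewrite eq_le; apply/andP; split.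
    apply: ge_sup => // _ [->|[y tyx ->]]; first exact: ltW.
    apply: g_le; rewrite leNgt; apply/negP => /t_lt.
    by rewrite ltNge tyx.
  by apply: ub_le_sup => //; right; exists x.
(* The logit, inverse of the logistic map [g]. *)
exists (fun v => ln (A v) - ln (1 - A v)).
  apply: measurable_funB; first exact: measurableT_comp.
  by apply: measurableT_comp => //; exact: measurable_funB.
move=> x; rewrite At.
have -> : 1 - g x = expR (- x) * g x.
  by rewrite /g; field; rewrite gt_eqF.
by rewrite lnM ?posrE ?expR_gt0// expRK; ring.
Qed.

End measurable_left_inverse.

(** * QR decomposition *)

Section householder.
Context {R : realType}.

Lemma dotmx_ge0 n (v : 'cV[R]_n) : 0 <= (v^T *m v) 0 0.
Proof. by rewrite mxE sumr_ge0// => i _; rewrite mxE -expr2 sqr_ge0. Qed.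

Lemma dotmx_eq0 n (v : 'cV[R]_n) : ((v^T *m v) 0 0 == 0) = (v == 0).
Proof.
rewrite mxE psumr_eq0; last by move=> i _; rewrite mxE -expr2 sqr_ge0.
apply/allP/eqP => [h|-> i _]; last by rewrite /= !mxE mulr0.
apply/matrixP => i j; rewrite ord1 [RHS]mxE.
have /= := h i (mem_index_enum _); rewrite mxE -expr2 sqrf_eq0 => /eqP ->.
by [].
Qed.

(* Householder reflection along [x - y]. *)
Lemma exists_reflection n (x y : 'cV[R]_n) : x^T *m x = y^T *m y ->
  exists W : 'M[R]_n, W^T *m W = 1%:M /\ W *m x = y.
Proof.
move=> xy; have [->|xny] := eqVneq x y.
  by exists 1%:M; rewrite trmx1 !mul1mx.
pose v := x - y; pose k := (v^T *m v) 0 0.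
have k0 : k != 0 by rewrite dotmx_eq0 subr_eq0.
have vv : v^T *m v = k%:M by rewrite [LHS]mx11_scalar.
pose c := 2 / k; pose N := v *m v^T; pose W := 1%:M - c *: N.
have NN : N *m N = k *: N.
  by rewrite /N mulmxA -(mulmxA v) vv mul_mx_scalar -scalemxAl.
have Wt : W^T = W.
  by rewrite /W linearB/= trmx1 linearZ/= /N trmx_mul trmxK.
exists W; split.
  rewrite Wt /W mulmxBl mul1mx mulmxBr mulmx1 -scalemxAl -scalemxAr NN.
  rewrite !scalerA.
  have -> : c * c * k = c + c by rewrite /c; field.
  by rewrite scalerDl [in X in _ - X]opprD addrA subrr sub0r opprK subrK.
have vT : v^T = x^T - y^T by rewrite /v linearB.
(* Equality of the norms of [x] and [y] makes the component of [x] along [v] exactly [v / 2], so the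
   reflection subtracts [v]. *)
have vx : v^T *m x = (k / 2)%:M.
  apply/matrixP => i j; rewrite !ord1 [RHS]mxE eqxx mulr1n.
  have -> : (v^T *m x) 0 0 = (x^T *m x) 0 0 - (y^T *m x) 0 0.
    by rewrite vT mulmxBl !mxE.
  have yx : (y^T *m x) 0 0 = (x^T *m y) 0 0.
    by rewrite -[y^T *m x]trmxK trmx_mul trmxK mxE.
  have : k = (x^T *m x) 0 0 - (x^T *m y) 0 0 - ((y^T *m x) 0 0 - (y^T *m y) 0 0).
    by rewrite /k vT {1}/v mulmxBl !mulmxBr !mxE.
  rewrite -xy yx; lra.
rewrite /W mulmxBl mul1mx -scalemxAl /N -mulmxA vx mul_mx_scalar scalerA.
have -> : c * (k / 2) = 1 by rewrite /c; field.
by rewrite scale1r /v subKr.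
Qed.

Lemma det_orthogonal n (W : 'M[R]_n) : W^T *m W = 1%:M -> `|\det W| = 1.
Proof.
move=> WW; have := congr1 determinant WW.
rewrite det_mulmx det_tr det1 -expr2 => /eqP; rewrite sqrf_eq1 => /orP[]/eqP ->.
  by rewrite normr1.
by rewrite normrN1.
Qed.

(** Induction on the size: a reflection sends the first column to its norm times the first basis
    vector, and the lower right block is treated recursively. The norm is nonzero because the
    determinant is. *)
Lemma exists_QR n (G : 'M[R]_n) : \det G != 0 ->
  exists W : 'M[R]_n, [/\ W^T *m W = 1%:M,
    forall i j : 'I_n, (j < i)%N -> (W *m G) i j = 0 &
    forall i, 0 < (W *m G) i i].
Proof.
elim: n G => [|n IH] G G0.
  by exists 1%:M; split; [rewrite trmx1 mul1mx|case|case].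
pose x : 'cV[R]_(1 + n) := lsubmx (G : 'M[R]_(1 + n)).
pose s := Num.sqrt ((x^T *m x) 0 0).
pose y : 'cV[R]_(1 + n) := col_mx s%:M 0.
have xy : x^T *m x = y^T *m y.
  rewrite /y tr_col_mx mul_row_col trmx0 mul0mx addr0 tr_scalar_mx.
  apply/matrixP => i j; rewrite !ord1 -scalar_mxM [RHS]mxE eqxx mulr1n.
  by rewrite -expr2 sqr_sqrtr// dotmx_ge0.
have [W0 [W0W0 W0x]] := exists_reflection xy.
pose G1 : 'M[R]_(1 + n) := W0 *m G.
have G1l : lsubmx G1 = y by rewrite -W0x /x /G1 -mulmx_lsub.
pose G' := dsubmx (rsubmx G1); pose g' := usubmx (rsubmx G1).
have G1E : G1 = block_mx s%:M g' 0 G'.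
  by rewrite block_mxEh vsubmxK -[LHS]hsubmxK G1l.
have detG1 : \det G1 = s * \det G' by rewrite G1E det_ublock det_scalar1.
have : \det G1 != 0.
  rewrite det_mulmx mulf_neq0//; have := det_orthogonal W0W0.
  by move=> /eqP; apply: contraTneq => ->; rewrite normr0 eq_sym oner_eq0.
rewrite detG1 mulf_eq0 negb_or => /andP[s0 G'0].
have [W' [W'W' W'tri W'pos]] := IH _ G'0.
pose U : 'M[R]_(1 + n) := block_mx 1%:M 0 0 W'.
have UU : U^T *m U = 1%:M.
  rewrite tr_block_mx !trmx0 trmx1 mulmx_block !mulmx0 !mul0mx mulmx1 !addr0 add0r.
  by rewrite W'W' -scalar_mx_block.
have UG : U *m G1 = block_mx s%:M g' 0 (W' *m G').
  by rewrite G1E mulmx_block !mulmx0 !mul0mx !mul1mx !addr0 !add0r.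
exists (U *m W0); split.
- by rewrite trmx_mul mulmxA -(mulmxA W0^T) UU mulmx1.
- move=> i j; rewrite -mulmxA UG.
  rewrite -(@fintype.splitK 1 n i) -(@fintype.splitK 1 n j).
  case: (@fintype.split 1 n i) => i'; case: (@fintype.split 1 n j) => j' /=.
  + by rewrite !ord1.
  + by rewrite !ord1.
  + by rewrite (@block_mxEdl R 1 n 1 n) mxE.
  + by rewrite (@block_mxEdr R 1 n 1 n) ltn_add2l; exact: W'tri.
- move=> i; rewrite -mulmxA UG -(@fintype.splitK 1 n i); case: (@fintype.split 1 n i) => i' /=.
  + by rewrite (@block_mxEul R 1 n 1 n) ord1 mxE eqxx mulr1n lt_def s0 sqrtr_ge0.
  + by rewrite (@block_mxEdr R 1 n 1 n).
Qed.

Lemma det_upper_triangular n (L : 'M[R]_n) :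
  (forall i j : 'I_n, (j < i)%N -> L i j = 0) -> \det L = \prod_i L i i.
Proof.
move=> tri; rewrite -det_tr det_trig; first by apply: eq_bigr => i _; rewrite mxE.
by apply/is_trig_mxP => i j ij; rewrite mxE tri.
Qed.

End householder.

(** * Feasibility of the optimized precoder *)

Section precoder_feasible.
Context {R : realType} (r m : nat) (Ht : 'M[R]_(r, r + m)) (alpha : 'cV[R]_(r + m)).

(** The constraints of the linear program, imposed on whole columns; they keep the precoded inputs
    in the unit interval. *)
Definition feasible_precoder (B : 'M[R]_(r, m)) :=
  forall j, lp_feasible [set: 'I_r]%SET (usubmx alpha) (alpha (rshift r j) 0) (col j B).

Lemma lp_feasible_extend (K : {set 'I_r}) (a : 'cV[R]_r) a0 (mu mu' : 'cV[R]_r) :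
  (forall k, mu' k 0 = if k \in K then mu k 0 else 0) ->
  lp_feasible K a a0 mu -> lp_feasible [set: 'I_r]%SET a a0 mu'.
Proof.
move=> mu'E [mu0 h1 h2].
have E (f : 'I_r -> R) :
    \sum_(k in [set: 'I_r]%SET) f k * mu' k 0 = \sum_(k in K) f k * mu k 0.
  rewrite [RHS]big_mkcond; apply: eq_big => [k|k _]; first by rewrite finset.in_setT.
  by rewrite mu'E; case: ifP => //; rewrite mulr0.
split; rewrite ?E//.
by move=> k _; rewrite mu'E; case: ifP => // /mu0.
Qed.

(** Whichever branch the comparison selects, the new column is the extension by zero of a feasible
    point. *)
Lemma update_step_feasible j (B B' : 'M[R]_(r, m)) :
  update_step Ht alpha j B B' -> feasible_precoder B -> feasible_precoder B'.
Proof.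
move=> [_ [mu1 [mu2 [[f1 _] [f2 _] ->]]]] fB j'.
set K := finset _ in f1 f2 *.
set b := if _ then _ else _.
have [->|jj] := eqVneq j' j; last first.
  rewrite (_ : col j' _ = col j' B)//; apply/matrixP => i k.
  by rewrite !mxE (negbTE jj).
have -> : col j (replace_col B j b) = b.
  by apply/matrixP => i k; rewrite !mxE eqxx ord1.
rewrite /b; case: ifP => _.
  by apply: lp_feasible_extend f1 => k; rewrite mxE.
by apply: lp_feasible_extend f2 => k; rewrite mxE finset.in_setC; case: ifP.
Qed.

Lemma circular_optimization_feasible ncycle (B : 'M[R]_(r, m)) :
  (forall k, 0 <= alpha k 0 <= 1) ->
  circular_optimization_E Ht alpha ncycle B -> feasible_precoder B.
Proof.
move=> a01; rewrite /circular_optimization_E.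
(* The starting matrix is feasible because the prescribed means lie in the unit interval. *)
have : feasible_precoder 0.
  move=> j; have /andP[aj0 aj1] := a01 (rshift r j).
  split => [k _||]; first by rewrite !mxE.
  - by rewrite big1// => k _; rewrite !mxE mulr0.
  - by rewrite big1 ?subr_ge0// => k _; rewrite !mxE mulr0.
move: (flatten _) (0 : 'M[R]_(r, m)) => js.
elim: js => [|j js IH] B0 fB0 /=; first by move=> ->.
by move=> [B1 /update_step_feasible/(_ fB0)]; exact: IH.
Qed.

End precoder_feasible.

(** * The precoded input law *)

Section precoded_input.
Context {R : realType} (r m : nat) (alpha : 'cV[R]_(r + m)) (B : 'M[R]_(r, m)).
Variable t : 'I_r -> R -> R.
Hypothesis mt : forall i, measurable_fun [set: R] (t i).

(** The affine precoding is centred at the means rather than at one half, which builds in the mean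
    constraints; the change of centre only affects the free offsets. *)
Definition precoded_input (x : r.-tuple R) : (r + m).-tuple R :=
  [tuple match fintype.split k with
         | inl i => t i (tnth x i)
         | inr j => alpha (rshift r j) 0 +
             \sum_i B i j * (t i (tnth x i) - alpha (lshift m i) 0)
         end | k < r + m].

Lemma precoded_input_lshift x i :
  tnth (precoded_input x) (lshift m i) = t i (tnth x i).
Proof. by rewrite tnth_mktuple (unsplitK (inl _ i)). Qed.

Lemma precoded_input_rshift x j : tnth (precoded_input x) (rshift r j) =
  alpha (rshift r j) 0 + \sum_i B i j * (t i (tnth x i) - alpha (lshift m i) 0).
Proof. by rewrite tnth_mktuple (unsplitK (inr _ j)). Qed.

Lemma measurable_precoded_input : measurable_fun [set: r.-tuple R] precoded_input.
Proof.
have mti i : measurable_fun [set: r.-tuple R] (fun x => t i (tnth x i)).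
  by apply: (measurableT_comp (mt i)); exact: measurable_tnth.
apply/measurable_fun_tnthP => k; rewrite -(fintype.splitK k).
case: (fintype.split k) => [i|j] /=.
- rewrite (_ : _ \o _ = fun x : r.-tuple R => t i (tnth x i))//.
  by apply/funext => x /=; rewrite precoded_input_lshift.
- rewrite (_ : _ \o _ = fun x : r.-tuple R => alpha (rshift r j) 0 +
      \sum_i B i j * (t i (tnth x i) - alpha (lshift m i) 0)).
    apply: measurable_funD => //; apply: measurable_sum => i.
    by apply: measurable_funM => //; exact: measurable_funB.
  by apply/funext => x /=; rewrite precoded_input_rshift.
Qed.

HB.instance Definition _ :=
  isMeasurableFun.Build _ _ _ _ precoded_input measurable_precoded_input.

Definition precoded_input_law : probability ((r + m).-tuple R) R :=
  distribution (gaussian_law 1 r) precoded_input.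

Lemma ae_precoded_input_law (Q : (r + m).-tuple R -> Prop) :
  measurable [set x | Q x] -> (forall x, Q (precoded_input x)) ->
  {ae precoded_input_law, forall x, Q x}.
Proof.
move=> mQ Qphi; exists (~` [set x | Q x]); split => //; first exact: measurableC.
have e : precoded_input @^-1` (~` [set x | Q x]) = set0.
  by apply/seteqP; split => // x /=; apply.
exact: etrans (congr1 (gaussian_law 1 r) e) (measure0 _).
Qed.

Hypothesis t01 : forall i x, 0 <= t i x <= 1.
Hypothesis t_mean : forall i,
  has_mean (normal_law 0 1) (t i) (alpha (lshift m i) 0).
Hypothesis fB : feasible_precoder alpha B.

(** As the entries of [B] are nonnegative, the extreme values correspond to all [t i] equal to 0 or
    all equal to 1; the two linear constraints bound precisely these. *)
Lemma precoded_input01 x k : 0 <= tnth (precoded_input x) k <= 1.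
Proof.
rewrite -(fintype.splitK k); case: (fintype.split k) => [i|j] /=.
  by rewrite precoded_input_lshift.
rewrite precoded_input_rshift; have [B0 hl hr] := fB j.
have B0' i : 0 <= B i j by have := B0 i (finset.in_setT _); rewrite mxE.
have lo : - \sum_i alpha (lshift m i) 0 * B i j <=
    \sum_i B i j * (t i (tnth x i) - alpha (lshift m i) 0).
  rewrite -sumrN; apply: ler_sum => i _.
  by have /andP[h0 _] := t01 i (tnth x i); have := B0' i; nra.
have hi : \sum_i B i j * (t i (tnth x i) - alpha (lshift m i) 0) <=
    \sum_i (1 - alpha (lshift m i) 0) * B i j.
  apply: ler_sum => i _.
  by have /andP[_ h1] := t01 i (tnth x i); have := B0' i; nra.
have hl' : \sum_i alpha (lshift m i) 0 * B i j <= alpha (rshift r j) 0.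
  apply: le_trans hl; rewrite le_eqVlt; apply/orP; left; apply/eqP.
  by apply: eq_big => [i|i _]; rewrite ?finset.in_setT// !mxE.
have hr' : \sum_i (1 - alpha (lshift m i) 0) * B i j <= 1 - alpha (rshift r j) 0.
  apply: le_trans hr; rewrite le_eqVlt; apply/orP; left; apply/eqP.
  by apply: eq_big => [i|i _]; rewrite ?finset.in_setT// !mxE.
by apply/andP; split; lra.
Qed.

Lemma precoded_input_mean k :
  has_mean precoded_input_law (fun x => tnth x k) (alpha k 0).
Proof.
apply: has_mean_distribution; first exact: measurable_tnth.
rewrite -(fintype.splitK k); case: (fintype.split k) => [i|j] /=.
  rewrite (_ : _ \o _ = fun x : r.-tuple R => t i (tnth x i)).
    exact: has_mean_tnth.
  by apply/funext => x /=; rewrite precoded_input_lshift.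
rewrite (_ : _ \o _ = cst (alpha (rshift r j) 0) \+ (fun x : r.-tuple R =>
    \sum_i B i j * (t i (tnth x i) - alpha (lshift m i) 0))); last first.
  by apply/funext => x /=; rewrite precoded_input_rshift.
rewrite -[X in has_mean _ _ X]addr0; apply: has_meanD; first exact: has_mean_cst.
have e0 : \sum_i B i j * 0 = 0 by rewrite big1// => i _; rewrite mulr0.
rewrite -[X in has_mean _ _ X]e0.
apply: has_mean_sum => i; apply: has_meanZ.
rewrite -(subrr (alpha (lshift m i) 0)).
apply: (has_meanD (f := fun x => t i (tnth x i)) (g := cst _)).
  exact: has_mean_tnth.
exact: has_mean_cst.
Qed.

Lemma precoded_input_equal_cost : equal_cost_law alpha precoded_input_law.
Proof.
move=> k; split.
  apply: ae_precoded_input_law; last by move=> x; exact: precoded_input01.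
  rewrite (_ : [set x | _] = (fun x : (r + m).-tuple R => tnth x k) @^-1` `[0, 1]).
    by rewrite -[X in measurable X]setTI; exact: measurable_tnth.
  by apply/seteqP; split => x /=; rewrite in_itv.
by rewrite unlock; have [] := precoded_input_mean k.
Qed.

Lemma precoded_input_precoded : precoded_law B precoded_input_law.
Proof.
(* The offsets that recentre the affine maps from the means to one half. *)
exists (fun j => alpha (rshift r j) 0 - 2^-1 -
  \sum_i B i j * (alpha (lshift m i) 0 - 2^-1)).
apply: ae_precoded_input_law.
  rewrite (_ : [set x | _] = \bigcap_(j in [set: 'I_m]) ((fun x : (r + m).-tuple R =>
      tnth x (rshift r j) - 2^-1 -
      (\sum_i B i j * (tnth x (lshift m i) - 2^-1) +
       (alpha (rshift r j) 0 - 2^-1 -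
        \sum_i B i j * (alpha (lshift m i) 0 - 2^-1)))) @^-1` [set 0])); last first.
    apply/seteqP; split => x /= h j; first by move=> _ /=; rewrite h subrr.
    by apply/eqP; rewrite -subr_eq0; apply/eqP; exact: (h j I).
  apply: fin_bigcap_measurable; first exact: finite_finset.
  move=> j _; rewrite -[X in measurable X]setTI.
  suff mF : measurable_fun [set: (r + m).-tuple R] (fun x : (r + m).-tuple R =>
      tnth x (rshift r j) - 2^-1 -
      (\sum_i B i j * (tnth x (lshift m i) - 2^-1) +
       (alpha (rshift r j) 0 - 2^-1 -
        \sum_i B i j * (alpha (lshift m i) 0 - 2^-1)))) by exact: mF.
  apply: measurable_funB; first by apply: measurable_funB => //; exact: measurable_tnth.
  apply: measurable_funD => //; apply: measurable_sum => i.
  apply: measurable_funM => //; apply: measurable_funB => //; exact: measurable_tnth.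
move=> x j; rewrite precoded_input_rshift.
under [in RHS]eq_bigr do rewrite precoded_input_lshift.
have -> : \sum_i B i j * (t i (tnth x i) - alpha (lshift m i) 0) =
    \sum_i B i j * (t i (tnth x i) - 2^-1) - \sum_i B i j * (alpha (lshift m i) 0 - 2^-1).
  by rewrite -sumrB; apply: eq_bigr => i _; ring.
ring.
Qed.

End precoded_input.

(** * The achievable rate *)

Section information_bound.
Context {R : realType} (r m : nat).
Variables (Ht : 'M[R]_(r, r + m)) (alpha : 'cV[R]_(r + m)) (B : 'M[R]_(r, m)).
Variable sigma : R.
Hypothesis sigma0 : 0 < sigma.

Let G := lsubmx Ht + rsubmx Ht *m B^T.
Let offset : 'cV[R]_r := rsubmx Ht *m (dsubmx alpha - B^T *m usubmx alpha).

Lemma precoded_channel (t : 'I_r -> R -> R) x :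
  Ht *m vec_of_tuple (precoded_input alpha B t x) =
  G *m (\col_i t i (tnth x i)) + offset.
Proof.
set tau := \col_i _.
have -> : vec_of_tuple (precoded_input alpha B t x) =
    col_mx tau (dsubmx alpha + B^T *m (tau - usubmx alpha)).
  apply/colP => k; rewrite -(fintype.splitK k); case: (fintype.split k) => [i|j] /=.
    by rewrite col_mxEu !mxE precoded_input_lshift.
  rewrite col_mxEd mxE precoded_input_rshift !mxE; congr (_ + _).
  by apply: eq_bigr => i _; rewrite !mxE.
rewrite -{1}[Ht]hsubmxK mul_row_col /G /offset mulmxDl -addrA; congr (_ + _).
by rewrite !mulmxDr !mulmxN !mulmxA addrCA.
Qed.

Variables (t T : 'I_r -> R -> R) (mu c : 'I_r -> R) (W : 'M[R]_r) (a b : R).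
Hypothesis mt : forall i, measurable_fun [set: R] (t i).
Hypothesis mT : forall i, measurable_fun [set: R] (T i).
Hypothesis tK : forall i, cancel (t i) (T i).
Hypothesis c0 : forall i, 0 < c i.
Hypothesis dt : forall i (x : R),
  is_derive x 1 (t i) (gauss_pdf x * expR (mu i * t i x) / c i).
Hypothesis t_mean : forall i,
  has_mean (normal_law 0 1) (t i) (alpha (lshift m i) 0).
Hypothesis WW : W^T *m W = 1%:M.
Let L := W *m G.
Hypothesis L_tri : forall i j : 'I_r, (j < i)%N -> L i j = 0.
Hypothesis L_pos : forall i, 0 < L i i.
Hypothesis a0 : 0 < a.
Hypothesis b0 : 0 < b.
Hypothesis ab : a ^+ 2 + b ^+ 2 = 1.

Let C i := score_const a b (L i i / sigma) (c i).

Let whitened i (y : r.-tuple R) : R :=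
  \sum_k W i k / sigma * (tnth y k - offset k 0).

Let noise i (w : (r + m).-tuple R * r.-tuple R) : R :=
  whitened i w.2 - \sum_j L i j / sigma * tnth w.1 (lshift m j).

(** The divergence compares laws of input-output pairs, so the score must be a function of such a
    pair: [T i] recovers the underlying normal variable from the input, and [noise] the whitened
    noise. *)
Let total_score (w : (r + m).-tuple R * r.-tuple R) : R :=
  \sum_i score a b (C i) (mu i) (tnth w.1 (lshift m i))
    (T i (tnth w.1 (lshift m i))) (noise i w).

Let phi := precoded_input alpha B t.
Let PX := precoded_input_law alpha B mt.
Let P := (PX \x gaussian_law sigma r)%E.

Let noiseE i x z : noise i (phi x, channel_output Ht (phi x, z)) =
  linear_form (fun k => W i k / sigma) z.
Proof.
rewrite /noise /whitened /=.
have -> : \sum_j L i j / sigma * tnth (phi x) (lshift m j) =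
    \sum_k W i k / sigma * (G *m (\col_i t i (tnth x i))) k 0.
  transitivity ((L *m (\col_i t i (tnth x i))) i 0 / sigma).
    rewrite mxE mulr_suml; apply: eq_bigr => j _.
    by rewrite precoded_input_lshift [X in _ = _ * X / _]mxE mulrAC.
  rewrite /L -mulmxA mxE mulr_suml; apply: eq_bigr => k _.
  by rewrite mulrAC.
rewrite -sumrB; apply: eq_bigr => k _.
rewrite tnth_mktuple /= precoded_channel [(_ + offset) k 0]mxE; ring.
Qed.

Let measurable_whitened i : measurable_fun [set: r.-tuple R] (whitened i).
Proof.
apply: measurable_sum => k; apply: measurable_funM => //.
by apply: measurable_funB => //; exact: measurable_tnth.
Qed.

Let measurable_score d (S : measurableType d) k u (f g h : S -> R) :
  measurable_fun [set: S] f -> measurable_fun [set: S] g ->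
  measurable_fun [set: S] h ->
  measurable_fun [set: S] (fun x => score a b k u (f x) (g x) (h x)).
Proof.
move=> mf mg mh; apply: measurable_funD; last first.
  by apply: measurable_funM => //; exact: measurable_funM.
apply: measurable_funD => //; apply: measurable_funM => //.
apply: measurable_funB; first exact: measurable_funM.
by apply: measurable_funM => //; exact: measurable_funX.
Qed.

Let measurable_total_score :
  measurable_fun [set: (r + m).-tuple R * r.-tuple R] total_score.
Proof.
have m1 k : measurable_fun [set: (r + m).-tuple R * r.-tuple R] (fun w => tnth w.1 k).
  by apply: (measurableT_comp (measurable_tnth k)); exact: measurable_fst.
apply: measurable_sum => i; apply: measurable_score => //.
  exact: (measurableT_comp (mT i)).
apply: measurable_funB.
  by apply: (measurableT_comp (measurable_whitened i)); exact: measurable_snd.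
by apply: measurable_sum => j; exact: measurable_funM.
Qed.

(** Rows of an orthogonal matrix are unit vectors; hence each whitened noise component has second
    moment at most 1. *)
Let W_row i : \sum_k (W i k / sigma) ^+ 2 = (sigma ^+ 2)^-1.
Proof.
have := congr1 (fun A : 'M[R]_r => A i i) (mulmx1C WW).
rewrite !mxE eqxx => h; rewrite -[RHS]mul1r -[X in X * _]h mulr_suml.
apply: eq_bigr => k _; rewrite mxE exprMn exprVn; ring.
Qed.

Let score_mean : exists2 V,
  \sum_i (C i + b ^+ 2 * (mu i * alpha (lshift m i) 0 - 2^-1)) <= V &
  has_mean P (fun u => total_score (u.1, channel_output Ht u)) V.
Proof.
have s0 : sigma != 0 by rewrite gt_eqF.
have /choice[v hv] i : exists v, v <= 1 /\ has_mean (gaussian_law sigma r)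
    (fun z => linear_form (fun k => W i k / sigma) z ^+ 2) v.
  have [v] := has_mean_sqr_linear_form (fun k => W i k / sigma) s0.
  by rewrite W_row divff ?expf_neq0//; exists v.
(* The product [0 * 0] is the mean of the cross term between the independent centred normal variable
   and noise. *)
exists (\sum_i (C i + b ^+ 2 * (mu i * alpha (lshift m i) 0 + - 2^-1 * v i) +
    a * b * (0 * 0))).
  apply: ler_sum => i _; have [v1 _] := hv i.
  rewrite !mulr0 addr0 lerD2l ler_wpM2l ?sqr_ge0//; lra.
apply: has_mean_prod_distribution.
  apply: (measurableT_comp measurable_total_score
    (g := fun u : (r + m).-tuple R * r.-tuple R => (u.1, channel_output Ht u))).
  by apply: measurable_fun_pair; [exact: measurable_fst|exact: measurable_funPT].
rewrite (_ : (fun u => _) = fun u : r.-tuple R * r.-tuple R => \sum_i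
    (C i + b ^+ 2 * (mu i * t i (tnth u.1 i) +
       - 2^-1 * linear_form (fun k => W i k / sigma) u.2 ^+ 2) +
     a * b * (tnth u.1 i * linear_form (fun k => W i k / sigma) u.2))); last first.
  apply/funext => -[x z] /=; apply: eq_bigr => i _.
  rewrite -/phi noiseE precoded_input_lshift tK /score; ring.
apply: has_mean_sum => i; have [_ hvi] := hv i.
have ht := has_mean_fst (gaussian_law sigma r) (has_mean_tnth i (t_mean i)).
have hz := has_mean_snd (gaussian_law 1 r) hvi.
have hx := has_mean_tnth i (has_mean_id_normal (@oner_neq0 R)).
have hxz := has_mean_prodM hx (has_mean_linear_form (fun k => W i k / sigma) s0).
exact: (has_meanD (has_meanD (has_mean_cst _ (C i))
  (has_meanZ _ (has_meanD (has_meanZ (mu i) ht) (has_meanZ _ hz))))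
  (has_meanZ (a * b) hxz)).
Qed.

(** Since [L] is upper triangular, the [i]-th term involves only coordinate [i] and later ones, the
    later ones through a single shift of the noise argument. *)
Let total_score_phi x y : total_score (phi x, y) = \sum_i
  score a b (C i) (mu i) (t i (tnth x i)) (tnth x i)
   (whitened i y - \sum_(j < r | (i < j)%N) L i j / sigma * t j (tnth x j) -
    L i i / sigma * t i (tnth x i)).
Proof.
apply: eq_bigr => i _; rewrite precoded_input_lshift tK; congr (score _ _ _ _ _ _ _).
rewrite /noise /= -addrA -opprD; congr (_ - _).
rewrite (bigID (fun j : 'I_r => (i < j)%N)) /=; congr (_ + _).
  by apply: eq_bigr => j _; rewrite precoded_input_lshift.
rewrite (bigD1 i) ?ltnn//= big1 ?addr0 ?precoded_input_lshift// => j /andP[ij ji].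
rewrite L_tri ?mul0r// ltn_neqAle leqNgt ij andbT.
by apply: contra ji => /eqP/val_inj ->.
Qed.

(** For a fixed output the exponential of the score is a triangular product, each factor of which is
    controlled by [score_bound]. *)
Let fiber_bound y : (\int[gaussian_law 1 r]_x (expR (total_score (phi x, y)))%:E <= 1)%E.
Proof.
pose K i x u := expR (score a b (C i) (mu i) (t i x) x (u - L i i / sigma * t i x)).
pose s i (x : r.-tuple R) :=
  whitened i y - \sum_(j < r | (i < j)%N) L i j / sigma * t j (tnth x j).
under eq_integral do rewrite total_score_phi expR_sum.
apply: (triangular_integral_le1 (K := K) (s := s)).
- by move=> i x u; exact: expR_ge0.
- move=> i; apply: measurableT_comp => //.
  have m1 : measurable_fun [set: R * R] (fun p : R * R => t i p.1).
    by apply: (measurableT_comp (mt i)); exact: measurable_fst.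
  apply: measurable_score => //.
  by apply: measurable_funB => //; exact: measurable_funM.
- move=> i; apply: measurable_funB => //.
  under eq_fun do rewrite big_mkcond.
  apply: measurable_sum => j; case: (i < j)%N => //.
  apply: measurable_funM => //.
  by apply: (measurableT_comp (mt j)); exact: measurable_tnth.
- move=> i x x' xx'; rewrite /s; congr (_ - _); apply: eq_bigr => j ij.
  by rewrite xx'.
- move=> i u; apply: score_bound => //.
  by rewrite divr_gt0.
Qed.

(** The variational bound is applied to [total_score]; under the product of the marginals the output
    can be frozen, and [fiber_bound] gives the normalisation. *)
Lemma information_rate_ge :
  ((\sum_i (C i + b ^+ 2 * (mu i * alpha (lshift m i) 0 - 2^-1)))%:E <=
   information_rate Ht sigma PX)%E.
Proof.
have [V leV hV] := score_mean.
rewrite /information_rate /mutual_information.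
set PXY := (X in kl_divergence X _).
have [intS SV] : has_mean PXY total_score V by exact: has_mean_distribution.
apply: (@le_trans _ _ V%:E); first by rewrite lee_fin.
rewrite -SV; apply: kl_divergence_ge => //.
have mE : measurable_fun [set: (r + m).-tuple R * r.-tuple R]
    (fun w => (expR (total_score w))%:E).
  by apply/measurable_EFinP; exact: measurableT_comp.
have E0 w : (0 <= (expR (total_score w))%:E)%E by rewrite lee_fin expR_ge0.
rewrite fubini_tonelli2//.
pose PY : probability _ R := distribution (PX \x gaussian_law sigma r)%E (channel_output Ht).
apply: (@le_trans _ _ (\int[PY]_y (cst 1 y)%:E)%E); last first.
  by rewrite (has_mean_cst PY 1).2.
apply: ge0_le_integral => //.
- by move=> y _; apply: integral_ge0.
- exact: (measurable_fun_fubini_tonelli_G _ mE).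
- exact/measurable_EFinP.
- move=> y _; rewrite /fubini_G.
  have mEy : measurable_fun [set: (r + m).-tuple R]
      (fun x => (expR (total_score (x, y)))%:E).
    exact: (measurableT_comp mE (g := fun x => (x, y))).
  rewrite ge0_integral_distribution//.
  have mE1 : measurable_fun [set: (r + m).-tuple R * r.-tuple R]
      (fun u => (expR (total_score (u.1, y)))%:E).
    by apply: (measurableT_comp mEy); exact: measurable_fst.
  rewrite (fubini_tonelli1 (m1 := PX) (m2 := gaussian_law sigma r)
    (fun u => (expR (total_score (u.1, y)))%:E))//.
  rewrite /fubini_F /=.
  have cstE v : (\int[gaussian_law sigma r]_z v%:E = v%:E)%E.
    exact: (has_mean_cst _ v).2.
  under eq_integral do rewrite cstE.
  by rewrite ge0_integral_distribution//; exact: fiber_bound.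
Qed.

End information_bound.

(** * Choice of the transport maps and of the rotation angle *)

Section achievable_rate.
Context {R : realType}.

(** The variational bound with score 0. *)
Lemma information_rate_ge0 r n (Ht : 'M[R]_(r, n)) sigma
    (PX : probability (n.-tuple R) R) : (0 <= information_rate Ht sigma PX)%E.
Proof.
rewrite /information_rate /mutual_information.
set P := (X in kl_divergence X _); set Q := (X in kl_divergence _ X).
have [int0 I0] := has_mean_cst P (0 : R).
apply: (@le_trans _ _ (\int[P]_x (cst 0 x)%:E)%E); first by rewrite I0.
apply: kl_divergence_ge => //=.
by rewrite expR0 (has_mean_cst Q 1).2.
Qed.

(** One input law serves all rotation angles, so the angle can be optimised afterwards. *)
Lemma precoded_rate_transport r m (Ht : 'M[R]_(r, r + m)) (alpha : 'cV[R]_(r + m))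
    (B : 'M[R]_(r, m)) sigma (h : 'I_r -> R) :
  0 < sigma -> feasible_precoder alpha B ->
  \det (lsubmx Ht + rsubmx Ht *m B^T) != 0 ->
  (forall i, 0 < alpha (lshift m i) 0 < 1) ->
  (forall i, h_TE (alpha (lshift m i) 0) = (h i)%:E) ->
  exists PX : probability ((r + m).-tuple R) R,
    [/\ equal_cost_law alpha PX, precoded_law B PX &
      forall a b : R, 0 < a -> 0 < b -> a ^+ 2 + b ^+ 2 = 1 ->
      ((r%:R * (- (a ^+ 2 * ln a) +
                b ^+ 2 * (ln (normal_peak 1) - ln sigma - ln b - 2^-1)) +
        b ^+ 2 * (ln `|\det (lsubmx Ht + rsubmx Ht *m B^T)| + \sum_i h i))%:E
       <= information_rate Ht sigma PX)%E].
Proof.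
move=> sigma0 fB; set G := lsubmx Ht + _ => detG alpha01 hE.
have /choice[q Hq] i : exists q : (R -> R) * R * R, [/\ 0 < q.2,
    forall x, 0 <= q.1.1 x <= 1,
    forall x : R, is_derive x 1 q.1.1 (gauss_pdf x * expR (q.1.2 * q.1.1 x) / q.2),
    (\int[normal_law 0 1]_x (q.1.1 x)%:E = (alpha (lshift m i) 0)%:E)%E &
    h_TE (alpha (lshift m i) 0) = (alpha (lshift m i) 0 * q.1.2 - ln q.2)%:E].
  by have [t [mu [c ?]]] := truncated_exponential_transport (alpha01 i); exists (t, mu, c).
pose t i := (q i).1.1; pose mu i := (q i).1.2; pose c i := (q i).2.
have c0 i : 0 < c i by have [] := Hq i.
have t01 i x : 0 <= t i x <= 1 by have [_ h1 _ _ _] := Hq i; exact: h1.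
have dt i (x : R) : is_derive x 1 (t i) (gauss_pdf x * expR (mu i * t i x) / c i).
  by have [_ _ h2 _ _] := Hq i; exact: h2.
have hmu i : alpha (lshift m i) 0 * mu i - ln (c i) = h i.
  by have [_ _ _ _] := Hq i; rewrite hE => -[->].
have mt i : measurable_fun [set: R] (t i).
  apply: continuous_measurable_fun => x; have ? := dt i x.
  by apply: differentiable_continuous; exact/derivable1_diffP.
have t_mean i : has_mean (normal_law 0 1) (t i) (alpha (lshift m i) 0).
  have [|v hv] := has_mean_bounded (normal_law 0 1) (c := 1) (mt i).
    by move=> x; have /andP[t0 t1] := t01 i x; rewrite ger0_norm.
  suff <- : v = alpha (lshift m i) 0 by exact: hv.
  by apply/EFin_inj; rewrite -hv.2; have [] := Hq i.
have /choice[T HT] i : exists T : R -> R, measurable_fun [set: R] T /\ cancel (t i) T.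
  have [|T mT tT] := @measurable_left_inverse R (t i); last by exists T.
  apply: is_derive_gt0_lt (dt i) _ => x.
  by rewrite divr_gt0// mulr_gt0 ?gauss_pdf_gt0 ?expR_gt0.
have mT i : measurable_fun [set: R] (T i) by have [] := HT i.
have tK i : cancel (t i) (T i) by have [] := HT i.
have [W [WW L_tri L_pos]] := exists_QR detG.
(* The diagonal of the triangular factor enters only through its product, which the orthogonal [W]
   preserves in absolute value. *)
have detL : \sum_i ln ((W *m G) i i) = ln `|\det G|.
  apply: expR_inj; rewrite expR_sum lnK ?posrE ?normr_gt0//.
  under eq_bigr do rewrite lnK ?posrE ?L_pos//.
  have <- : `|\det (W *m G)| = `|\det G|.
    by rewrite det_mulmx normrM (det_orthogonal WW) mul1r.
  by rewrite (det_upper_triangular L_tri) gtr0_norm// prodr_gt0.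
exists (precoded_input_law alpha B mt); split.
- exact: precoded_input_equal_cost.
- exact: precoded_input_precoded.
move=> a b a0 b0 ab.
have := information_rate_ge sigma0 mt mT tK c0 dt t_mean WW L_tri L_pos a0 b0 ab.
apply: le_trans; rewrite lee_fin le_eqVlt; apply/orP; left; apply/eqP.
rewrite -detL -big_split/= mulr_sumr.
rewrite -[X in X%:R * _]card_ord -sum1_card natr_sum mulr_suml -big_split/=.
apply: eq_bigr => i _; rewrite -hmu /score_const ln_div ?posrE//; ring.
Qed.

Lemma ln_normal_peak1 : ln (normal_peak 1 : R) = - (ln (2 * pi) / 2).
Proof.
have pi2 : 0 < 2 * pi :> R by rewrite mulr_gt0 ?pi_gt0.
rewrite /normal_peak expr1n mul1r -mulr_natl lnV ?posrE ?sqrtr_gt0//.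
congr (- _); have sq : Num.sqrt (2 * pi) ^+ 2 = 2 * pi :> R by rewrite sqr_sqrtr// ltW.
have /(lnXn 2) : 0 < Num.sqrt (2 * pi) :> R by rewrite sqrtr_gt0.
by rewrite sq => ->; rewrite [ln _ *+ 2]mulr2n; field.
Qed.

Lemma precoded_rate r m (Ht : 'M[R]_(r, r + m)) (alpha : 'cV[R]_(r + m))
    (B : 'M[R]_(r, m)) sigma (h : 'I_r -> R) :
  (0 < r)%N -> 0 < sigma -> feasible_precoder alpha B ->
  let D := `|\det (lsubmx Ht + rsubmx Ht *m B^T)| in
  0 < D -> (forall i, 0 < alpha (lshift m i) 0 < 1) ->
  (forall i, h_TE (alpha (lshift m i) 0) = (h i)%:E) ->
  let N := D `^ (2 / r%:R) * expR (2 / r%:R * \sum_i h i) *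
    (2 * pi * expR 1 * sigma ^+ 2)^-1 in
  exists PX : probability ((r + m).-tuple R) R,
    [/\ equal_cost_law alpha PX, precoded_law B PX &
      ((r%:R / 2 * ln (1 + N))%:E <= information_rate Ht sigma PX)%E].
Proof.
move=> r0 sigma0 fB D D0 alpha01 hE N.
have detG : \det (lsubmx Ht + rsubmx Ht *m B^T) != 0 by rewrite -normr_gt0.
have [PX [eqc pre rate]] := precoded_rate_transport sigma0 fB detG alpha01 hE.
exists PX; split => //.
have pi0 : 0 < pi :> R by exact: pi_gt0.
have den0 : 0 < 2 * pi * expR 1 * sigma ^+ 2.
  by rewrite !mulr_gt0 ?expR_gt0 ?exprn_gt0.
have N0 : 0 < N by rewrite !mulr_gt0 ?powR_gt0 ?expR_gt0 ?invr_gt0.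
have N1 : 0 < 1 + N by rewrite addr_gt0.
have rR : r%:R != 0 :> R by rewrite pnatr_eq0 -lt0n.
pose x := ln (1 + N); pose y := ln N.
have yE : y = 2 / r%:R * (ln D + \sum_i h i) - (ln (2 * pi) + 1 + 2 * ln sigma).
  rewrite /y /N lnM ?posrE ?mulr_gt0 ?powR_gt0 ?expR_gt0 ?invr_gt0//.
  rewrite lnM ?posrE ?powR_gt0 ?expR_gt0// ln_powR expRK lnV ?posrE//.
  rewrite lnM ?posrE ?mulr_gt0 ?expR_gt0 ?exprn_gt0//.
  rewrite lnM ?posrE ?mulr_gt0 ?expR_gt0// expRK lnXn//.
  by rewrite -[ln sigma *+ 2]mulr_natl; ring.
(* Then [a ^+ 2 = 1 / (1 + N)] and [b ^+ 2 = N / (1 + N)], and each coordinate contributes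
   [(a ^+ 2 + b ^+ 2) * (x / 2)], half of [ln (1 + N)]. *)
pose a := expR (- (x / 2)); pose b := expR ((y - x) / 2).
have a2 : a ^+ 2 = (1 + N)^-1.
  rewrite /a -expRM_natl (_ : 2 * - (x / 2) = - x); last by field.
  by rewrite expRN lnK.
have b2 : b ^+ 2 = N / (1 + N).
  rewrite /b -expRM_natl (_ : 2 * ((y - x) / 2) = y - x); last by field.
  by rewrite expRD expRN !lnK.
have ab : a ^+ 2 + b ^+ 2 = 1 by rewrite a2 b2; field; rewrite gt_eqF.
apply: le_trans (rate a b (expR_gt0 _) (expR_gt0 _) ab).
rewrite lee_fin le_eqVlt; apply/orP; left; apply/eqP.
rewrite /a /b !expRK -/a -/b -/D ln_normal_peak1.
have -> : ln D + \sum_i h i = r%:R / 2 * (y + (ln (2 * pi) + 1 + 2 * ln sigma)).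
  by rewrite yE; field.
have -> : a ^+ 2 = 1 - b ^+ 2 by rewrite -ab; ring.
by rewrite -/x; field.
Qed.

End achievable_rate.

Theorem proposition2 (R : realType) (nR r m : nat)
    (H : 'M[R]_(nR, r + m)) (Ht : 'M[R]_(r, r + m))
    (alpha : 'cV[R]_(r + m)) (sigma : R) (ncycle : nat) (B : 'M[R]_(r, m)) :
  (forall i j, 0 <= H i j) ->
  (0 < r)%N ->
  \rank H = r ->
  reduced_channel H Ht ->
  \det (lsubmx Ht) != 0 ->
  (forall k, 0 <= alpha k 0 <= 1) ->
  0 < sigma ->
  (0 < ncycle)%N ->
  circular_optimization_E Ht alpha ncycle B ->
  let D := `|\det (lsubmx Ht + rsubmx Ht *m B^T)| in
  let rate :=
    ((r%:R / 2)%:E *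
     lne (1 + (D `^ (2 / r%:R))%:E *
              expeR ((2 / r%:R)%:E * \sum_(i < r) h_TE (alpha (lshift m i) 0)%R)
              * ((2 * pi * expR 1 * sigma ^+ 2)^-1)%:E))%E in
  (rate <= capacity_E Ht alpha sigma)%E /\
  exists PX : probability ((r + m).-tuple R) R,
    [/\ equal_cost_law alpha PX, precoded_law B PX &
        (rate <= information_rate Ht sigma PX)%E].
Proof.
move=> _ r0 _ _ _ alpha01 sigma0 _ opt D rate.
have fB := circular_optimization_feasible alpha01 opt.
suff [PX [eqc pre le]] : exists PX : probability ((r + m).-tuple R) R,
    [/\ equal_cost_law alpha PX, precoded_law B PX &
        (rate <= information_rate Ht sigma PX)%E].
  split; last by exists PX.
  by apply: le_trans le _; apply: ereal_sup_ubound; exists PX.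
have r2 : 0 < 2 / r%:R :> R by rewrite divr_gt0// ltr0n.
(* A zero rate is achieved by constant inputs equal to their means, as information is
   nonnegative. *)
have degenerate : rate = 0%E -> exists PX : probability ((r + m).-tuple R) R,
    [/\ equal_cost_law alpha PX, precoded_law B PX &
        (rate <= information_rate Ht sigma PX)%E].
  move=> ->; pose t (i : 'I_r) : R -> R := cst (alpha (lshift m i) 0).
  have mt i : measurable_fun [set: R] (t i) by exact: measurable_cst.
  exists (precoded_input_law alpha B mt); split.
  - apply: precoded_input_equal_cost => // i; last exact: has_mean_cst.
    by move=> x; exact: alpha01.
  - exact: precoded_input_precoded.
  - exact: information_rate_ge0.
have [D0|D0] := eqVneq D 0.
  apply: degenerate; rewrite /rate D0 powR0 ?gt_eqF// !mul0e adde0 lne1 mule0.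
  by [].
have D_gt0 : 0 < D by rewrite lt_def D0 normr_ge0.
have [alpha_oo|] := boolP [forall i : 'I_r, 0 < alpha (lshift m i) 0 < 1].
  have {}alpha_oo i : 0 < alpha (lshift m i) 0 < 1 by exact: (forallP alpha_oo).
  have hE i : h_TE (alpha (lshift m i) 0) = (fine (h_TE (alpha (lshift m i) 0)))%:E.
    by rewrite fineK// /h_TE alpha_oo.
  have [PX [eqc pre le]] := precoded_rate r0 sigma0 fB D_gt0 alpha_oo hE.
  exists PX; split => //.
  pose N := D `^ (2 / r%:R) * expR (2 / r%:R *
    \sum_i fine (h_TE (alpha (lshift m i) 0))) * (2 * pi * expR 1 * sigma ^+ 2)^-1.
  suff -> : rate = (r%:R / 2 * ln (1 + N))%:E by exact: le.
  have N0 : 0 <= N.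
    by rewrite !(mulr_ge0, powR_ge0, expR_ge0, invr_ge0, pi_ge0)// ltW.
  rewrite /rate; under eq_bigr do rewrite hE.
  rewrite sumEFin -(EFinM (2 / r%:R)) [expeR _]/= -(EFinM (D `^ _)) -EFinM -/N.
  by rewrite -EFinD lne_EFin ?ltr_wpDr// EFinM.
(* Some free input has mean 0 or 1: its entropy is [-oo], the whole sum is [-oo], and its
   exponential is 0. *)
move=> /forallPn[i alpha_i]; apply: degenerate.
have -> : rate = ((r%:R / 2)%:E * lne 1)%E.
  congr (_ * lne _)%E; rewrite (_ : (\sum_(i < r) _ = -oo)%E).
    by rewrite gt0_muleNy ?lte_fin//= mule0 mul0e adde0.
  by apply/esum_eqNyP; exists i; split => //; rewrite /h_TE (negbTE alpha_i).
by rewrite lne1 mule0.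
Qed.
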